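(* Let $s=p/q$ be rational in lowest terms. The phase $\chi(n)=e^{-2\pi in^{2}p/q}$ is periodic in $n$ with period $q$, and its discrete Fourier expansion yields the revival $$u_{p/q}(z)=\sum_{r=0}^{q-1}\hat c(r)\,u_{0}\Big(z-\frac{2r}{q}\Big),\qquad\hat c(r)=\frac1q\sum_{n=0}^{q-1}e^{-2\pi i(pn^{2}-rn)/q},$$ a finite superposition of translated square waves whose coefficients are generalized quadratic Gauss sums. Consequently $w_{p/q}=|u_{p/q}|^{2}$ is constant on the cells of the lattice $\{l/q\}$ in $(0,1)$, and for every $f\in\mathcal{D}_{+}$, $$f_{(p/q)\cdot4/\pi}=w_{p/q}(F)\,f,$$ a histogram reweighting of $f$ on at most $q$ of its own quantile cells, of total mass one. In particular the rational-time orbit of every law consists of explicitly computable histogram modulations of that law.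
   Context: $\mathcal{D}_{+}$ is the set of probability densities on $\mathbb{R}$ that are continuous and strictly positive on an open interval and vanish outside it; $F$ is the distribution function of $f$. On the circle $\mathbb{R}/2\mathbb{Z}$ let $u_{s}(z)=\sum_{n\ \mathrm{odd}}\frac{2}{i\pi n}\,e^{-2\pi in^{2}s}\,e^{i\pi nz}$ (sum over all positive and negative odd integers $n$, convergence in $L^{2}$), so that $u_{0}$ is the square wave equal to $1$ on $(0,1)$ and $-1$ on $(1,2)$; restricted to $(0,1)$, $u_{s}$ is the evolution $e^{-i\tau H_{0}}\mathbf{1}$, where $H_{0}=-\frac12\frac{d^{2}}{dz^{2}}$ with Dirichlet conditions on $(0,1)$ and $s=\pi\tau/4$. $w_{s}=|u_{s}|^{2}$. The carpet flow of $f$ at time $\tau$ is $f_{\tau}=w_{s}(F)\,f$ with $s=\pi\tau/4$. Equalities are almost everywhere. *)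

(* Defs.v *)
From mathcomp Require Export all_boot all_order all_algebra.
From mathcomp Require Export all_classical all_reals all_analysis.
From mathcomp Require Export complex.

Set Implicit Arguments.
Unset Strict Implicit.
Unset Printing Implicit Defensive.

Export Order.TTheory GRing.Theory Num.Theory.
Export numFieldNormedType.Exports.

#[global] Open Scope classical_set_scope.
#[global] Open Scope ring_scope.

Section CarpetWave.
Variable R : realType.
Implicit Types (s z : R) (n p : int) (q N r : nat) (u : R -> R[i]).

Definition cis (t : R) : R[i] := (cos t +i* sin t)%C.

Definition phase s n : R[i] := cis (- (2 * pi * n%:~R ^+ 2 * s)).

Definition wave_term s n z : R[i] :=
  2 / (0 +i* (pi * n%:~R))%C * phase s n * cis (pi * n%:~R * z).

(* The odd integers n with |n| < 2 N are the 2 k + 1 and - (2 k + 1), k < N. *)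
Definition wave_partial_sum s N z : R[i] :=
  \sum_(k < N) (wave_term s (k.*2.+1)%:Z z + wave_term s (- (k.*2.+1)%:Z) z).

(* Functions on the circle R/2Z are 2-periodic functions on R, and u_s is an
   element of L^2 of the circle: [is_carpet_wave s u] says that u is a
   (Borel) representative of the L^2 sum of the series. *)
Definition is_carpet_wave s u : Prop :=
  [/\ periodic u 2,
      measurable_fun setT (fun z => complex.Re (u z)),
      measurable_fun setT (fun z => complex.Im (u z)) &
      (\int[lebesgue_measure]_(z in `[0%R, 2%R])
         ((Normc.normc (u z - wave_partial_sum s N z)) ^+ 2)%:E)%E
        @[N --> \oo] --> 0%E].

(* A representative of u_s; two of them agree almost everywhere. *)
Definition carpet_wave s : R -> R[i] := xget (cst 0) [set u | is_carpet_wave s u].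

Definition carpet_weight s z : R := Normc.normc (carpet_wave s z) ^+ 2.

(* Equal to 1 on [0, 1[ and to -1 on [1, 2[, and 2-periodic. *)
Definition square_wave z : R[i] := (-1) ^ Num.floor z.

Definition gauss_sum (a b : int) (c : nat) : R[i] :=
  \sum_(n < c) cis (2 * pi * (a%:~R * n%:R ^+ 2 + b%:~R * n%:R) / c%:R).

Definition chat p q r : R[i] :=
  (q%:R)^-1 *
  \sum_(n < q) cis (- (2 * pi * (p%:~R * n%:R ^+ 2 - r%:R * n%:R) / q%:R)).

(* The superposition of translated square waves at the midpoint of the cell
   ]l/q, (l+1)/q[: no translate jumps inside a cell, so this is the value of
   |u_{p/q}|^2 on the whole cell. *)
Definition cell_weight p q (l : nat) : R :=
  Normc.normc
    (\sum_(r < q) chat p q r *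
       square_wave ((l%:R + 2^-1) / q%:R - 2 * r%:R / q%:R)) ^+ 2.

End CarpetWave.

Section CarpetFlow.
Variable R : realType.
Implicit Types (f : R -> R) (tau x : R).

(* The class D_+; the mass-one condition forces the interval I to be nonempty,
   and f is nonnegative and Borel by the other conditions. *)
Definition D_plus f : Prop :=
  (exists I : set R,
    [/\ open I, is_interval I,
        {within I, continuous f},
        forall x, I x -> 0 < f x &
        forall x, ~ I x -> f x = 0]) /\
  (\int[lebesgue_measure]_x (f x)%:E = 1)%E.

Definition dist_fun f x : R := \int[lebesgue_measure]_(y in `]-oo, x]) f y.

Definition carpet_flow f tau x : R :=
  carpet_weight (pi * tau / 4) (dist_fun f x) * f x.

(* ]Q(l/q), Q((l+1)/q)[ for the quantile function Q of f in D_+. *)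
Definition quantile_cell f (q l : nat) : set R :=
  dist_fun f @^-1` `]l%:R / q%:R, l.+1%:R / q%:R[.

End CarpetFlow.

(* Main.v *)
From HB Require Import structures.
Require Import Defs.
From mathcomp Require Import measurable_realfun ring lra zify.

Set Implicit Arguments.
Unset Strict Implicit.
Unset Printing Implicit Defensive.

(** Write s = p/q.  The phases of the modes of the wave are periodic in n with
    period q, so the discrete Fourier transform expands them in the characters
    n |-> exp(- 2 i pi r n / q) with coefficients [chat], the normalized Gauss
    sums ([phase_dft]).  Multiplying the n-th mode by such a character is the
    same as translating it by 2r/q; hence every partial sum of the series of
    u_s is exactly the superposition, with weights [chat], of translates of the
    corresponding partial sum of the series of u_0
    ([wave_partial_sum_superposition]).  Mean-square convergence on the circle
    is stable under finite linear combinations and translations, so the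
    revival formula follows from two facts: the mean-square limit of the series
    determines a wave almost everywhere ([is_carpet_wave_unique]), and the
    Fourier series of the square wave converges to it
    ([is_carpet_wave_square_wave]).

    For the second fact, orthogonality of the odd sines turns the mean-square
    error after N terms into 1 - (8 / pi^2) (1 + 1/9 + ... + 1/(2N-1)^2), so one
    needs that the sum of the inverse odd squares is pi^2/8.  This is obtained
    by halving angles: the sum of 1/sin^2 over the angles (2k+1) pi / 2^(m+2),
    k < 2^m, is multiplied by 4 when m increases by one
    ([sum_invr_sin_sqr]), and 1/sin^2 x exceeds 1/x^2 by at most 1 on
    ]0, pi/2[.

    Translates of the square wave by multiples of 2/q jump only at points of
    the lattice (1/q) Z, so the weight w_s is constant on the cells.  That the
    cell values have mean 1 is a finite Parseval identity
    ([sum_cell_weight]): the cyclic autocorrelation of [chat] is a Kronecker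
    delta because all phases have modulus one.

    For a law with density f and distribution function F, the law of F is
    uniform on [0, 1] ([density_prob_dist_fun]).  Therefore a property that
    holds for almost all z in [0, 1] holds at z = F x for almost all x with
    f x <> 0 ([ae_dist_fun]), which transports the cell values to the quantile
    cells of f, and each of the q cells has probability 1/q, which gives the
    total mass one. *)

#[local] Arguments conjc : simpl never.
#[local] Arguments cis : simpl never.

(** * The circle exponential *)

Section CircleExponential.
Variable R : realType.
Implicit Types (a b t : R).

Lemma cisD a b : cis (a + b) = cis a * cis b.
Proof. by rewrite /cis cosD sinD; simpc; rewrite addrC [X in (_ +i* X)%C]addrC. Qed.

Lemma cis0 : cis (0 : R) = 1.
Proof. by rewrite /cis cos0 sin0. Qed.

Lemma conjc_cis a : conjc (cis a) = cis (- a).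
Proof. by rewrite /cis /conjc cosN sinN. Qed.

Lemma conjcM (x y : R[i]) : conjc (x * y) = conjc x * conjc y.
Proof. exact: rmorphM. Qed.

Lemma conjc_sum (I : Type) (r : seq I) (P : pred I) (F : I -> R[i]) :
  conjc (\sum_(i <- r | P i) F i) = \sum_(i <- r | P i) conjc (F i).
Proof. exact: rmorph_sum. Qed.

Lemma cisMn a n : cis (a *+ n) = cis a ^+ n.
Proof.
by elim: n => [|n ih]; rewrite ?mulr0n ?cis0 ?expr0// mulrS cisD ih exprS.
Qed.

Lemma cis_2pi_int (k : int) : cis (2 * pi * k%:~R : R) = 1.
Proof.
have cisn (n : nat) : cis (2 * pi * n%:R : R) = 1.
  by rewrite mulr_natr cisMn mulr_natl /cis cos2pi sin2pi expr1n.
case: k => n; first exact: cisn.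
by rewrite NegzE mulrNz mulrN -conjc_cis cisn conjc1.
Qed.

(** The half-angle formula writes [cos t] as [1 - 2 sin (t / 2) ^ 2], and
    [t / 2] lies in the interval where the sine is positive. *)
Lemma cis_eq1 t : 0 < t < 2 * pi -> cis t != 1.
Proof.
move=> /andP[t0 t2]; apply/eqP => /(congr1 (@complex.Re R)) /=.
have -> : t = (t / 2) *+ 2 by rewrite -mulr_natr divfK.
rewrite cos_mulr2n.
have s0 : 0 < sin (t / 2) by apply: sin_gt0_pi; rewrite ?divr_gt0//; lra.
have := sin2cos2 (t / 2) => e.
have : 0 < sin (t / 2) ^+ 2 by rewrite exprn_gt0.
rewrite e mulr2n; lra.
Qed.

End CircleExponential.

(** * Sums over a period *)

Section PeriodicSums.
Variables (V : zmodType) (q : nat) (g : int -> V).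
Hypothesis gq : forall m, g (m + q%:Z) = g m.

(** Shifting the window by one step exchanges the term that leaves for the
    term that enters, and these two differ by one period. *)
Lemma sum_periodic_shift a :
  \sum_(l < q) g (l%:Z + a) = \sum_(l < q) g l%:Z.
Proof.
have step b : \sum_(l < q) g (l%:Z + (b + 1)) = \sum_(l < q) g (l%:Z + b).
  case: q gq => [|q'] gq'; first by rewrite !big_ord0.
  rewrite big_ord_recr [in RHS]big_ord_recl /= addrC; congr (_ + _).
    by rewrite add0r -[RHS]gq'; congr g; lia.
  by apply: eq_bigr => i _; congr g; rewrite /bump leq0n; lia.
have pos (n : nat) b : \sum_(l < q) g (l%:Z + (b + n%:Z)) = \sum_(l < q) g (l%:Z + b).
  by elim: n => [|n ih]; rewrite ?addr0// -addn1 PoszD addrA step.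
case: a => n.
  by rewrite -[Posz n]add0r pos; under eq_bigr do rewrite addr0.
rewrite NegzE -(pos n.+1); apply: eq_bigr => i _; congr g; lia.
Qed.

End PeriodicSums.

(** * The square wave *)

Section SquareWave.
Variable R : realType.

Lemma square_waveS (z : R) : square_wave (z + 1) = - square_wave z.
Proof.
by rewrite /square_wave floorDrz ?rpred1// floor1 expfzDr ?oppr_eq0 ?oner_eq0// expr1z mulrN1.
Qed.

Lemma square_wave_per (z : R) : square_wave (z + 2) = square_wave z.
Proof. by rewrite -[2]/(1 + 1) addrA !square_waveS opprK. Qed.

Lemma square_wave_real (z : R) : square_wave z = 1 \/ square_wave z = -1.
Proof.
rewrite /square_wave expN1r -signr_odd.
by case: odd; rewrite ?expr1 ?expr0; [right|left].
Qed.

End SquareWave.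

(** * Discrete Fourier inversion and Parseval for the Gauss coefficients *)

Section Revival.
Variables (R : realType) (p : int) (q : nat).
Hypothesis q_gt0 : (0 < q)%N.

Let q0 : (q%:R : R) != 0.
Proof. by rewrite pnatr_eq0 -lt0n. Qed.

Let qC0 : (q%:R : R[i]) != 0.
Proof. by rewrite pnatr_eq0 -lt0n. Qed.

(** The character of Z/q; all the exponentials of the revival formula are
    values of it, which reduces their algebra to that of integer exponents. *)
Definition root_char (k : int) : R[i] := cis (2 * pi * k%:~R / q%:R).
Local Notation w := root_char.

Lemma root_charD k l : w (k + l) = w k * w l.
Proof. by rewrite /w -cisD; congr cis; rewrite intrD; field. Qed.

Lemma root_char0 : w 0 = 1.
Proof. by rewrite /w mulr0 mul0r cis0. Qed.

Lemma conjc_root_char k : conjc (w k) = w (- k).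
Proof. by rewrite /w conjc_cis mulrNz mulrN mulNr. Qed.

Lemma root_char_mulq k : w (k * q%:Z) = 1.
Proof. by rewrite /w -(cis_2pi_int R k); congr cis; rewrite intrM; field. Qed.

Lemma root_char_neq1 (k : nat) : (0 < k < q)%N -> w k%:Z != 1.
Proof.
move=> /andP[k0 kq]; apply: cis_eq1.
have qp : 0 < q%:R :> R by rewrite ltr0n.
rewrite divr_gt0 ?mulr_gt0 ?pi_gt0 ?ltr0n//=.
by rewrite ltr_pdivrMr// ltr_pM2l ?mulr_gt0 ?pi_gt0// ltr_nat.
Qed.

(** Geometric sum with ratio [root_char k], a q-th root of unity that is 1
    exactly when q divides k. *)
Lemma sum_root_char (k : int) :
  \sum_(r < q) w (r%:Z * k) = (q %| k)%Z%:R * q%:R.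
Proof.
have wX r : w (r%:Z * k) = w k ^+ r.
  elim: r => [|r ih]; first by rewrite mul0r root_char0 expr0.
  by rewrite intS mulrDl mul1r root_charD ih exprS.
under eq_bigr do rewrite wX.
have [kq|kq] := boolP (q %| k)%Z.
  case/dvdzP: kq => m ->; rewrite root_char_mulq mul1r.
  by under eq_bigr do rewrite expr1n; rewrite sumr_const card_ord.
rewrite mul0r.
have wk1 : w k != 1.
  rewrite (divz_eq k q) root_charD root_char_mulq mul1r.
  have : (k %% q)%Z != 0 by apply: contra kq => /eqP/dvdz_mod0P.
  have : (k %% q)%Z < q by rewrite ltz_mod//; lia.
  have : 0 <= (k %% q)%Z by rewrite modz_ge0//; lia.
  case: (k %% q)%Z => // m _ mq m0.
  by apply: root_char_neq1; apply/andP; split; lia.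
apply: (mulfI (x := w k - 1)); first by rewrite subr_eq0.
by rewrite -subrX1 mulr0 -wX mulrC root_char_mulq subrr.
Qed.

Local Notation s := (p%:~R / q%:R : R).

Lemma phaseE n : phase s n = w (- (p * n ^+ 2)).
Proof. by rewrite /phase /w; congr cis; rewrite mulrNz expr2 !intrM; field. Qed.

Lemma phase_periodic n : phase s (n + q%:Z) = phase s n.
Proof.
rewrite !phaseE.
have -> : - (p * (n + q%:Z) ^+ 2) =
  - (p * n ^+ 2) + (- (p * (2 * n + q%:Z))) * q%:Z by ring.
by rewrite root_charD root_char_mulq mulr1.
Qed.

(** The Gauss coefficients at all integer indices, so that sums over a period
    can be shifted freely. *)
Definition chatz (r : int) : R[i] :=
  q%:R^-1 * \sum_(n < q) phase s n * w (r * n%:Z).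

Lemma chatE (r : nat) : chat R p q r = chatz r%:Z.
Proof.
rewrite /chat /chatz; congr (_ * _); apply: eq_bigr => n _.
by rewrite phaseE -root_charD /w; congr cis;
  rewrite intrD mulrNz expr2 !intrM -!pmulrn; field.
Qed.

Lemma chat_gauss (r : nat) : chat R p q r = (q%:R)^-1 * gauss_sum R (- p) r%:Z q.
Proof.
rewrite /chat /gauss_sum; congr (_ * _); apply: eq_bigr => n _; congr cis.
by rewrite mulrNz -pmulrn; field.
Qed.

Lemma chatz_per r : chatz (r + q%:Z) = chatz r.
Proof.
congr (_ * _); apply: eq_bigr => n _; congr (_ * _).
by rewrite mulrDl root_charD [q%:Z * _]mulrC root_char_mulq mulr1.
Qed.

(** Exactly one index below q is congruent to [n]; shifting the window to start
    at [n] makes it the first one. *)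
Lemma sum_residue (V : zmodType) (g : int -> V) (n : int) :
  (forall m, g (m + q%:Z) = g m) ->
  \sum_(m < q) (if (q %| m%:Z - n)%Z then g m%:Z else 0) = g n.
Proof.
move=> gq.
pose h (m : int) := if (q %| m)%Z then g (m + n) else 0.
have hq m : h (m + q%:Z) = h m by rewrite /h rpredDr ?dvdzz// addrAC gq.
rewrite (eq_bigr (fun m : 'I_q => h (m%:Z + - n))); last first.
  by move=> m _; rewrite /h subrK.
rewrite (sum_periodic_shift hq) (bigD1 (Ordinal q_gt0))//= big1 ?addr0.
  by rewrite /h dvdz0 add0r.
move=> i; rewrite -val_eqE/= => i0; rewrite /h ifN//.
apply/negP; rewrite /dvdz/= => /dvdn_leq; rewrite lt0n => /(_ i0).
by rewrite leqNgt ltn_ord.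
Qed.

(** Exchanging the two sums and summing the characters over r keeps only the
    index of the residue class of [n]. *)
Lemma phase_dft n :
  phase s n = \sum_(r < q) chat R p q r * cis (- (2 * pi * r%:R * n%:~R / q%:R)).
Proof.
have wE (r : nat) : cis (- (2 * pi * r%:R * n%:~R / q%:R)) = w (- (r%:Z * n)).
  by rewrite /w; congr cis; rewrite mulrNz intrM -pmulrn; field.
under eq_bigr do rewrite wE chatE /chatz -mulrA big_distrl/=.
rewrite -big_distrr/= exchange_big/=.
rewrite (eq_bigr (fun m : 'I_q => q%:R *
   (if (q %| m%:Z - n)%Z then phase s m%:Z else 0))); last first.
  move=> m _; under eq_bigr do rewrite -mulrA -root_charD -mulrN -mulrDr.
  rewrite -big_distrr/= sum_root_char mulrCA [LHS]mulrC.
  by case: ifP; rewrite ?(mulr0, mul0r, mul1r, mulr1)// mulrC.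
rewrite -big_distrr/= (@sum_residue _ (phase s)); last exact: phase_periodic.
by rewrite mulKf.
Qed.

(** The double sum over frequencies is reduced by orthogonality of characters
    to its diagonal, on which the unimodular phases cancel; what is left is the
    sum of the character [t] over a period. *)
Lemma chatz_autocorrelation (t : nat) : (t < q)%N ->
  \sum_(r < q) chatz (t%:Z + r%:Z) * conjc (chatz r%:Z) = (t == 0%N)%:R.
Proof.
move=> tq.
have ph1 n : phase s n * conjc (phase s n) = 1.
  by rewrite phaseE conjc_root_char -root_charD subrr root_char0.
pose F (n m : nat) := phase s n%:Z * conjc (phase s m%:Z) * w (t%:Z * n%:Z).
transitivity (q%:R^-1 ^+ 2 * \sum_(n < q) \sum_(m < q)
   \sum_(r < q) F n m * w (r%:Z * (n%:Z - m%:Z))).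
  under [X in _ = _ * X]eq_bigr do rewrite exchange_big/=.
  rewrite exchange_big/= big_distrr/=; apply: eq_bigr => r _.
  rewrite /chatz conjcM conjc_inv conjc_nat conjc_sum.
  rewrite mulrACA -expr2; congr (_ * _).
  rewrite big_distrl/=; apply: eq_bigr => n _.
  rewrite big_distrr/=; apply: eq_bigr => m _.
  rewrite conjcM conjc_root_char /F.
  rewrite mulrDl root_charD mulrBr root_charD; ring.
rewrite (eq_bigr (fun n : 'I_q => q%:R * w (n%:Z * t%:Z))); last first.
  move=> n _.
  rewrite (eq_bigr (fun m : 'I_q => if (q %| m%:Z - n%:Z)%Z then q%:R * F n m else 0)).
    rewrite (@sum_residue _ (fun m => q%:R *
      (phase s n%:Z * conjc (phase s m) * w (t%:Z * n%:Z)))).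
      by rewrite ph1 mul1r mulrC [X in w X]mulrC mulrC.
    by move=> m; rewrite phase_periodic.
  move=> m _; rewrite -big_distrr/= sum_root_char -opprB rpredN.
  by case: ifP => _; rewrite ?(mul0r, mulr0, mul1r)// mulrC.
rewrite -big_distrr/= sum_root_char.
have -> : (q %| t%:Z)%Z = (t == 0%N).
  case: t tq {F} => [|t tq]; first by rewrite dvdz0.
  by apply/negbTE/negP => /(dvdn_leq (ltn0Sn t)); rewrite leqNgt tq.
by field.
Qed.

(** The square wave at the midpoint of the m-th cell of the lattice (1/q) Z. *)
Definition cell_sign (m : int) : R[i] := square_wave ((m%:~R + 2^-1 : R) / q%:R).
Local Notation h := cell_sign.

Lemma cell_sign_half m : h (m + q%:Z) = - h m.
Proof.
by rewrite /h -square_waveS; congr square_wave; rewrite intrD -pmulrn; field.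
Qed.

Lemma cell_sign_per m : h (m + 2 * q%:Z) = h m.
Proof. by rewrite mulr_natl mulr2n addrA !cell_sign_half opprK. Qed.

(** The value of the superposition on the l-th cell; a translation by 2r/q is
    a shift by 2r cells. *)
Definition revival (l : int) : R[i] := \sum_(r < q) chatz r%:Z * h (l - 2 * r%:Z).

Lemma cell_weightE (l : nat) :
  ((cell_weight R p q l)%:C)%C = revival l%:Z * conjc (revival l%:Z).
Proof.
have nE (x : R[i]) : `|x| = ((Normc.normc x)%:C)%C by [].
rewrite -sqr_normc nE /cell_weight [LHS]rmorphXn; congr (_ ^+ 2).
congr ((Normc.normc _)%:C)%C; apply: eq_bigr => r _; rewrite chatE; congr (_ * _).
by congr square_wave; rewrite intrD mulrNz intrM -!pmulrn; field.
Qed.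

(** Parseval on the q cells.  The signs change under a shift by q, but products
    of two of them, and hence the correlations [B] below, are q-periodic.
    Expanding the squared modulus and shifting the summation variables,
    the coefficients enter only through their autocorrelation, a Kronecker
    delta; what remains is [B 0 = q]. *)
Lemma sum_cell_weight : \sum_(l < q) cell_weight R p q l = q%:R.
Proof.
have hr m : conjc (h m) = h m.
  by rewrite /h; case: (square_wave_real ((m%:~R + 2^-1 : R) / q%:R)) => ->;
    [exact: conjc1|exact: rmorphN1].
have hh m : h m * h m = 1.
  by rewrite /h; case: (square_wave_real ((m%:~R + 2^-1 : R) / q%:R)) => ->;
    rewrite ?mulrNN mulr1.
apply: (@complexI R); rewrite rmorph_sum/=; under eq_bigr do rewrite cell_weightE.
pose B (t : int) := \sum_(l < q) h (l%:Z - 2 * t) * h l%:Z.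
have Bq t : B (t + q%:Z) = B t.
  by apply: eq_bigr => l _; rewrite -[in LHS](cell_sign_per (_ - _)); congr (h _ * _); ring.
have hhq (a b m : int) : h (m + q%:Z - a) * h (m + q%:Z - b) = h (m - a) * h (m - b).
  by rewrite ![_ + q%:Z - _]addrAC !cell_sign_half mulrNN.
have BE (r r' : int) :
    \sum_(l < q) h (l%:Z - 2 * r) * h (l%:Z - 2 * r') = B (r - r').
  rewrite -(sum_periodic_shift (g := fun l => h (l - 2 * r) * h (l - 2 * r'))
    _ (2 * r')); last by move=> m; exact: hhq.
  by apply: eq_bigr => l _; congr (h _ * h _); ring.
transitivity (\sum_(r' < q) \sum_(r < q)
   chatz r%:Z * conjc (chatz r'%:Z) * B (r%:Z - r'%:Z)).
  under eq_bigr do rewrite /revival conjc_sum big_distrl/=.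
  rewrite exchange_big/= [RHS]exchange_big/=; apply: eq_bigr => r _.
  under eq_bigr do rewrite big_distrr/=.
  rewrite exchange_big/=; apply: eq_bigr => r' _.
  rewrite -BE big_distrr/=; apply: eq_bigr => l _.
  by rewrite conjcM hr; ring.
transitivity (\sum_(r' < q) \sum_(t < q)
   chatz (t%:Z + r'%:Z) * conjc (chatz r'%:Z) * B t%:Z).
  apply: eq_bigr => r' _.
  rewrite -(sum_periodic_shift (g := fun r =>
    chatz r * conjc (chatz r'%:Z) * B (r - r'%:Z)) _ r'%:Z).
    by apply: eq_bigr => t _; rewrite addrK.
  by move=> m; rewrite chatz_per addrAC Bq.
rewrite exchange_big/= (eq_bigr (fun t : 'I_q => (t == 0%N :> nat)%:R * B t%:Z)); last first.
  by move=> t _; rewrite -big_distrl/= chatz_autocorrelation.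
rewrite (bigD1 (Ordinal q_gt0))//= big1 => [|t]; last first.
  by rewrite -val_eqE/= => /negPf ->; rewrite mul0r.
rewrite mul1r addr0 /B; under eq_bigr do rewrite mulr0 subr0 hh.
by rewrite sumr_const card_ord rmorph_nat.
Qed.

End Revival.

(** * Orthogonality of the odd sine modes on the unit interval *)

Section TrigonometricIntegrals.
Variable R : realType.
Implicit Types (f g : R -> R) (c a z : R).
Local Notation mu := (@lebesgue_measure R).

(** Exact integration on the unit interval, in a form that is closed under
    linear combinations: [f] is continuous and has a primitive on the real line
    that increases by [c] from 0 to 1. *)
Definition unit_primitive f c : Prop :=
  continuous f /\
  exists2 G : R -> R, (forall z, is_derive z (1 : R) G (f z)) & G 1 - G 0 = c.

Lemma unit_primitive_integral f c : unit_primitive f c ->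
  (\int[mu]_(z in `[0%R, 1%R]) (f z)%:E)%E = c%:E.
Proof.
move=> [cf [G dG <-]].
have cG : continuous G.
  by move=> x; apply/differentiable_continuous/derivable1_diffP; case: (dG x).
rewrite (@continuous_FTC2 _ f G)//.
- exact: continuous_subspaceT.
- split; first by move=> x _; case: (dG x).
  + exact/cvg_at_right_filter/cG.
  + exact/cvg_at_left_filter/cG.
- by move=> x _; rewrite derive1E; case: (dG x).
Qed.

Lemma unit_primitive_ext f g c : f =1 g -> unit_primitive f c -> unit_primitive g c.
Proof. by move/funext ->. Qed.

Lemma unit_primitive1 : unit_primitive (fun=> 1) 1.
Proof.
split; first by move=> x; exact: cvg_cst.
by exists id => [z|]; [exact: is_derive_id|rewrite subr0].
Qed.

Lemma unit_primitiveD f g c a : unit_primitive f c -> unit_primitive g a ->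
  unit_primitive (fun z => f z + g z) (c + a).
Proof.
move=> [cf [F dF <-]] [cg [G dG <-]]; split.
  by move=> x; apply: cvgD; [exact: cf|exact: cg].
exists (F + G) => [z|]; last by rewrite /= !fctE; ring.
exact: is_deriveD.
Qed.

Lemma unit_primitiveZ f c a : unit_primitive f c ->
  unit_primitive (fun z => a * f z) (a * c).
Proof.
move=> [cf [F dF <-]]; split.
  by move=> x; apply: cvgMr; exact: cf.
exists (a \*: F) => [z|]; last by rewrite /= /GRing.scale/=; ring.
exact: is_deriveZ.
Qed.

Lemma unit_primitive0 : unit_primitive (fun=> 0) 0.
Proof.
have := unit_primitiveZ 0 unit_primitive1; rewrite [X in unit_primitive _ X]mul0r.
by apply: unit_primitive_ext => z; rewrite mul0r.
Qed.

Lemma unit_primitive_sum n (f : nat -> R -> R) (c : nat -> R) :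
  (forall k, unit_primitive (f k) (c k)) ->
  unit_primitive (fun z => \sum_(k < n) f k z) (\sum_(k < n) c k).
Proof.
move=> H; elim: n => [|n ih].
  by rewrite big_ord0; apply: unit_primitive_ext unit_primitive0 => z; rewrite big_ord0.
rewrite big_ord_recr /=; apply: unit_primitive_ext (unit_primitiveD ih (H n)) => z.
by rewrite big_ord_recr.
Qed.

Lemma is_derive_dilation (F : R -> R) a z d : is_derive (a * z) 1 F d ->
  is_derive z 1 (fun x => F (a * x)) (d * a).
Proof.
move=> dF; apply: (@is_derive1_comp _ F (fun x => a * x)).
by have := is_deriveZ a (is_derive_id z (1 : R)); rewrite /GRing.scale/= mulr1.
Qed.

Lemma continuous_dilation (F : R -> R) a : continuous F ->
  continuous (fun x => F (a * x)).
Proof.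
by move=> cF x; apply: continuous_comp; [apply: cvgMr; exact: cvg_id|exact: cF].
Qed.

Lemma unit_primitive_sin a : a != 0 ->
  unit_primitive (fun z => sin (a * z)) ((1 - cos a) / a).
Proof.
move=> a0; split; first exact: continuous_dilation (@continuous_sin R).
exists (- a^-1 \*: (fun z => cos (a * z))) => [z|]; last first.
  by rewrite /= /GRing.scale/= mulr1 mulr0 cos0; field.
have := is_deriveZ (- a^-1) (is_derive_dilation (is_derive_cos (a * z))).
by rewrite /GRing.scale/= [_ * (- _ * _)](_ : _ = sin (a * z))//; field.
Qed.

Lemma unit_primitive_cos a : a != 0 ->
  unit_primitive (fun z => cos (a * z)) (sin a / a).
Proof.
move=> a0; split; first exact: continuous_dilation (@continuous_cos R).
exists (a^-1 \*: (fun z => sin (a * z))) => [z|]; last first.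
  by rewrite /= /GRing.scale/= mulr1 mulr0 sin0; field.
have := is_deriveZ a^-1 (is_derive_dilation (is_derive_sin (a * z))).
by rewrite /GRing.scale/= [_ * (_ * _)](_ : _ = cos (a * z))//; field.
Qed.

Lemma sin_pi_nat n : sin (pi * n%:R : R) = 0.
Proof.
elim: n => [|n ih]; first by rewrite mulr0 sin0.
by rewrite -natr1 mulrDr mulr1 sinDpi ih oppr0.
Qed.

Lemma cos_pi_odd k : cos (pi * (k.*2.+1)%:R : R) = -1.
Proof.
elim: k => [|k ih]; first by rewrite mulr1 cospi.
rewrite doubleS -natr1 mulrDr mulr1 cosDpi -natr1 mulrDr mulr1 cosDpi opprK.
exact: ih.
Qed.

Definition odd_mode k z : R := sin (pi * (k.*2.+1)%:R * z).
Definition odd_coef k : R := 4 / (pi * (k.*2.+1)%:R).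
Definition sine_sum N z : R := \sum_(k < N) odd_coef k * odd_mode k z.

Let pi0 : (pi : R) != 0. Proof. by rewrite gt_eqF ?pi_gt0. Qed.

Let podd0 k : (pi * (k.*2.+1)%:R : R) != 0.
Proof. by rewrite mulf_neq0// pnatr_eq0. Qed.

Lemma unit_primitive_odd_mode k : unit_primitive (odd_mode k) (odd_coef k / 2).
Proof.
have := unit_primitive_sin (podd0 k); rewrite cos_pi_odd.
suff -> : (1 - -1) / (pi * (k.*2.+1)%:R) = odd_coef k / 2 by [].
by rewrite /odd_coef; move: (podd0 k); set a := pi * _ => a0; field.
Qed.

(** Product to sum: the frequencies [k - j] and [k + j + 1] are integer
    multiples of 2 pi, so the cosines integrate to zero, except the one of
    frequency zero. *)
Lemma unit_primitive_odd_mode_mul k j :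
  unit_primitive (fun z => odd_mode k z * odd_mode j z) ((k == j)%:R / 2).
Proof.
wlog kj : k j / (j <= k)%N.
  move=> H; case/orP: (leq_total j k) => kj; first exact: H.
  rewrite eq_sym; apply: unit_primitive_ext (H _ _ kj) => z; exact: mulrC.
have cosE z : odd_mode k z * odd_mode j z = 2^-1 * cos (pi * (k - j).*2%:R * z)
    + (- 2^-1) * cos (pi * (k + j).+1.*2%:R * z).
  have -> : pi * (k - j).*2%:R * z = pi * k.*2.+1%:R * z - pi * j.*2.+1%:R * z.
    by rewrite -!addnn !(natrD, =^~ natr1) natrB//; ring.
  have -> : pi * (k + j).+1.*2%:R * z = pi * k.*2.+1%:R * z + pi * j.*2.+1%:R * z.
    by rewrite -!addnn !(natrD, =^~ natr1); ring.
  by rewrite cosB cosD /odd_mode; field.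
apply: unit_primitive_ext (fun z => esym (cosE z)) _.
have neg : unit_primitive (fun z => - 2^-1 * cos (pi * (k + j).+1.*2%:R * z)) 0.
  rewrite -[X in unit_primitive _ X](mulr0 (- 2^-1)).
  apply: unit_primitiveZ; have := @unit_primitive_cos (pi * (k + j).+1.*2%:R).
  by rewrite sin_pi_nat mul0r; apply; rewrite mulf_neq0// pnatr_eq0.
have [kj'|kj'] := eqVneq k j.
  subst j; rewrite subnn -[X in unit_primitive _ X]addr0; apply: (unit_primitiveD _ neg).
  rewrite mul1r -[X in unit_primitive _ X]mulr1; apply: unit_primitiveZ.
  by apply: unit_primitive_ext unit_primitive1 => z; rewrite mulr0 mul0r cos0.
rewrite mul0r -[X in unit_primitive _ X]addr0; apply: (unit_primitiveD _ neg).
rewrite -[X in unit_primitive _ X](mulr0 (2^-1)).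
apply: unit_primitiveZ; have := @unit_primitive_cos (pi * (k - j).*2%:R).
by rewrite sin_pi_nat mul0r; apply; rewrite mulf_neq0// pnatr_eq0; lia.
Qed.

(** On the unit interval the square wave is the constant 1 and [sine_sum N] is
    its orthogonal projection on the first N odd modes, so the squared error is
    the squared norm of 1 minus that of the projection. *)
Lemma unit_primitive_square_error N :
  unit_primitive (fun z => (1 - sine_sum N z) ^+ 2)
                 (1 - \sum_(k < N) odd_coef k ^+ 2 / 2).
Proof.
have H1 : unit_primitive (sine_sum N) (\sum_(k < N) odd_coef k ^+ 2 / 2).
  rewrite (eq_bigr (fun k : 'I_N => odd_coef k * (odd_coef k / 2))); last first.
    by move=> k _; rewrite expr2 mulrA.
  apply: (@unit_primitive_sum N (fun k z => odd_coef k * odd_mode k z)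
     (fun k => odd_coef k * (odd_coef k / 2))) => k.
  exact/unit_primitiveZ/unit_primitive_odd_mode.
have H2 : unit_primitive (fun z => sine_sum N z ^+ 2)
    (\sum_(k < N) odd_coef k ^+ 2 / 2).
  have H k : unit_primitive
      (fun z => \sum_(j < N) (odd_coef k * odd_coef j) * (odd_mode k z * odd_mode j z))
      (\sum_(j < N) (odd_coef k * odd_coef j) * ((k == j)%:R / 2)).
    apply: (@unit_primitive_sum N
     (fun j z => (odd_coef k * odd_coef j) * (odd_mode k z * odd_mode j z))
     (fun j => (odd_coef k * odd_coef j) * ((k == j)%:R / 2))) => j.
    exact/unit_primitiveZ/unit_primitive_odd_mode_mul.
  rewrite [X in unit_primitive _ X](_ : _ =
      \sum_(k < N) \sum_(j < N) (odd_coef k * odd_coef j) * ((val k == j)%:R / 2)).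
    apply: unit_primitive_ext (unit_primitive_sum N H) => z.
    rewrite expr2 /sine_sum big_distrl/=; apply: eq_bigr => k _.
    by rewrite big_distrr/=; apply: eq_bigr => j _; rewrite mulrACA.
  apply: eq_bigr => k _; rewrite (bigD1 k)//= big1 ?addr0 => [|j].
    by rewrite eqxx expr2 mul1r.
  by rewrite -val_eqE eq_sym/= => /negPf ->; rewrite mul0r mulr0.
have := unit_primitiveD unit_primitive1 (unit_primitiveD (unit_primitiveZ (-2) H1) H2).
set S := \sum_(k < N) _; rewrite (_ : 1 + (-2 * S + S) = 1 - S); last by ring.
by apply: unit_primitive_ext => z; ring.
Qed.

End TrigonometricIntegrals.

(** * The sum of the inverse squares of the odd integers *)

Section OddBasel.
Variable R : realType.
Implicit Types x : R.

(** The difference [sin x - x * cos x] vanishes at 0 and has derivative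
    [x * sin x], which is nonnegative up to pi. *)
Lemma mul_cos_le_sin x : 0 <= x <= pi -> x * cos x <= sin x.
Proof.
move=> /andP[x0 xpi].
pose f : R -> R := sin - id * cos.
have df y : is_derive y (1 : R) f (y * sin y).
  have -> : y * sin y = cos y - (y *: - sin y + cos y *: 1).
    by rewrite /GRing.scale/=; ring.
  by apply: is_deriveB.
have : f 0 <= f x.
  apply: (@ger0_derive1_le_cc _ f 0 pi) => //.
  - move=> y; rewrite in_itv/= => /andP[y0 ypi].
    rewrite derive1E (@derive_val _ _ _ _ _ _ _ (df y)) mulr_ge0 ?(ltW y0)//.
    by rewrite sin_ge0_pi// !ltW.
  - apply: continuous_subspaceT => y.
    by apply/differentiable_continuous/derivable1_diffP; case: (df y).
  - by rewrite in_itv/= lexx pi_ge0.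
  - by rewrite in_itv/= x0.
by rewrite /f !fctE sin0 mul0r subr0 subr_ge0.
Qed.

Lemma invr_sin_sqr_le x : 0 < x < pi / 2 -> (sin x ^+ 2)^-1 <= (x ^+ 2)^-1 + 1.
Proof.
move=> /andP[x0 xpi].
have s0 : 0 < sin x by rewrite sin_gt0_pihalf// x0.
have c0 : 0 < cos x by rewrite cos_gt0_pihalf// xpi andbT; lra.
have h : x * cos x <= sin x by apply: mul_cos_le_sin; lra.
have -> : (sin x ^+ 2)^-1 = (cos x / sin x) ^+ 2 + 1.
  rewrite expr_div_n cos2sin2; field; exact: lt0r_neq0.
rewrite lerD2r -exprVn lerXn2r ?nnegrE ?divr_ge0 ?invr_ge0 ?(ltW x0) ?(ltW c0) ?(ltW s0)//.
by rewrite ler_pdivrMr// mulrC ler_pdivlMr// mulrC.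
Qed.

Lemma invr_sin_sqr_half x : sin (x / 2) != 0 -> cos (x / 2) != 0 ->
  (sin (x / 2) ^+ 2)^-1 + (sin (pi / 2 - x / 2) ^+ 2)^-1 = 4 * (sin x ^+ 2)^-1.
Proof.
move=> s0 c0.
have -> : sin (pi / 2 - x / 2) = cos (x / 2).
  by rewrite -opprB sinN sinBpihalf opprK.
have -> : sin x = 2 * sin (x / 2) * cos (x / 2).
  by rewrite -[in LHS](divfK (_ : 2 != 0) x)// mulr_natr sin_mulr2n -mulr_natr; ring.
have := cos2Dsin2 (x / 2).
move: (sin _) (cos _) s0 c0 => s c s0 c0 e.
rewrite -[LHS]mul1r -{1}[1](divff (_ : (s * c) ^+ 2 != 0)) ?expf_neq0 ?mulf_neq0//.
have -> : 4 * ((2 * s * c) ^+ 2)^-1 = ((s * c) ^+ 2)^-1 * 1 by field; rewrite c0.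
by rewrite -e; field; rewrite c0.
Qed.

(** The midpoints of the partition of [0, pi/2] into 2^m equal intervals. *)
Definition dyadic_angle m k : R := (k.*2.+1)%:R * pi / (2 ^ m.+2)%:R.

Let p2 m : 0 < (2 ^ m)%:R :> R.
Proof. by rewrite ltr0n expn_gt0. Qed.

Lemma dyadic_angle_itv m k : (k < 2 ^ m)%N -> 0 < dyadic_angle m k < pi / 2.
Proof.
move=> km; rewrite /dyadic_angle divr_gt0 ?mulr_gt0 ?pi_gt0 ?ltr0n ?expn_gt0//=.
rewrite ltr_pdivrMr ?p2//.
have -> : pi / 2 * (2 ^ m.+2)%:R = (2 ^ m.+1)%:R * pi :> R.
  by rewrite expnS natrM; field.
by rewrite ltr_pM2r ?pi_gt0// ltr_nat expnS; lia.
Qed.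

(** At level m + 1 the angles are the halves [x / 2] of the angles of level m
    and their complements [pi / 2 - x / 2]; each such pair contributes four
    times the term of [x]. *)
Lemma sum_invr_sin_sqr m :
  \sum_(k < 2 ^ m) (sin (dyadic_angle m k) ^+ 2)^-1 = 2 * (4 ^ m)%:R.
Proof.
elim: m => [|m ih].
  rewrite big_ord1 /dyadic_angle mul1r.
  have a : 2 * (pi / (2 ^ 2)%:R) = pi / 2 :> R by field.
  have := cos_mulr2n (pi / (2 ^ 2)%:R : R).
  rewrite -[_ *+ 2 in LHS]mulr_natl a cos_pihalf cos2sin2 => h.
  have -> : sin (pi / (2 ^ 2)%:R) ^+ 2 = 2^-1 :> R by move: h; rewrite mulr2n; lra.
  by rewrite invrK mulr1.
have halfE k : dyadic_angle m.+1 k = dyadic_angle m k / 2.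
  by rewrite /dyadic_angle [(2 ^ m.+3)%N]expnSr natrM; field; rewrite gt_eqF.
have -> : (2 ^ m.+1 = 2 ^ m + 2 ^ m)%N by rewrite expnS mul2n addnn.
rewrite big_split_ord/= [X in _ + X](reindex_inj rev_ord_inj)/= -big_split/=.
rewrite [(4 ^ _)%N]expnS natrM mulrCA -ih big_distrr/=; apply: eq_bigr => k _.
have /andP[x0 xpi] := dyadic_angle_itv (ltn_ord k).
have -> : dyadic_angle m.+1 (2 ^ m + (2 ^ m - k.+1)) = pi / 2 - dyadic_angle m k / 2.
  have H (M j : nat) : 0 < M%:R :> R -> (j < M)%N ->
      (M + (M - j.+1)).*2.+1%:R * pi / (4 * M)%:R / 2 =
      pi / 2 - j.*2.+1%:R * pi / (4 * M)%:R / 2 :> R.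
    move=> M0 jM.
    have -> : (M + (M - j.+1)).*2.+1%:R = 4 * M%:R - j.*2.+1%:R :> R.
      by rewrite -natrM -natrB; [congr _%:R|]; lia.
    by rewrite natrM; field; exact: lt0r_neq0.
  rewrite halfE /dyadic_angle.
  have -> : (2 ^ m.+2 = 4 * 2 ^ m)%N by rewrite !expnS mulnA.
  exact: H.
rewrite halfE invr_sin_sqr_half//; apply/lt0r_neq0.
  by rewrite sin_gt0_pihalf//; lra.
by rewrite cos_gt0_pihalf//; lra.
Qed.

Definition square_error N : R := 1 - \sum_(k < N) odd_coef R k ^+ 2 / 2.

(** In the identity for the sum of 1/sin^2, replace each term by the larger
    1/x^2 + 1: the terms 1/x^2 give the odd coefficients and the 2^m ones are
    negligible against the total 2 * 4^m. *)
Lemma square_error_dyadic m : square_error (2 ^ m) <= ((2 ^ m)%:R)^-1.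
Proof.
have := @ler_sum R 'I_(2 ^ m) (index_enum _) predT _ _
  (fun k _ => invr_sin_sqr_le (dyadic_angle_itv (ltn_ord k))).
rewrite sum_invr_sin_sqr big_split/= sumr_const card_ord -mulr_natl mulr1.
have -> : \sum_(k < 2 ^ m) (dyadic_angle m k ^+ 2)^-1 =
    (2 * (4 ^ m)%:R) * \sum_(k < 2 ^ m) odd_coef R k ^+ 2 / 2.
  rewrite big_distrr/=; apply: eq_bigr => k _; rewrite /dyadic_angle /odd_coef.
  have -> : (4 ^ m = 2 ^ m * 2 ^ m)%N by rewrite -expnMn.
  have -> : (2 ^ m.+2 = 4 * 2 ^ m)%N by rewrite !expnS mulnA.
  have k0 : k.*2.+1%:R != 0 :> R by rewrite pnatr_eq0.
  have M0 := lt0r_neq0 (p2 m); have pi0 := lt0r_neq0 (pi_gt0 R).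
  rewrite !natrM; move: (_.*2.+1%:R : R) ((2 ^ m)%:R : R) (pi : R) k0 M0 pi0 => j M c j0 M0 c0.
  by field; rewrite j0 c0.
rewrite /square_error; set S := \sum_(k < _) _ => h.
have e4 : (4 ^ m)%:R = (2 ^ m)%:R * (2 ^ m)%:R :> R by rewrite -natrM -expnMn.
have P := p2 m; set M : R := (2 ^ m)%:R in h e4 P *.
rewrite e4 in h.
rewrite -[leLHS]mulr1 -[X in _ * X](divff (lt0r_neq0 P)) mulrA ler_pdivrMr//.
rewrite mulVf ?lt0r_neq0//.
rewrite -(ler_pM2r P) mul1r.
have : 2 * (M * M) * (1 - S) <= M by lra.
nra.
Qed.

End OddBasel.

(** * Translates and Lebesgue measure *)

Section Translation.
Variable R : realType.
Local Notation mu := (@lebesgue_measure R).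
Implicit Types (a : R) (h : R -> \bar R).

(** Typed on the measurable space that carries Lebesgue measure, so that its
    pushforward is again a measure there. *)
Definition translation a (x : measurableTypeR R) : measurableTypeR R := (x : R) + a.

Lemma measurable_translation a : measurable_fun setT (translation a).
Proof. exact: measurable_funD. Qed.

Lemma lebesgue_measure_translation a (A : set R) : measurable A ->
  pushforward mu (translation a) A = mu A.
Proof.
move=> mA; apply/esym.
apply: (lebesgue_measure_unique (mu := pushforward mu (translation a))) => //=.
  exact: measurable_translation.
move=> _ _ [[b c]] _ <-.
rewrite /pushforward.
have -> : translation a @^-1` `]b, c]%classic = `]b - a, c - a]%classic.
  by apply/seteqP; split => x /=; rewrite !in_itv/= ltrBlDr lerBrDr.
rewrite !lebesgue_measure_itv/= !lte_fin ltrD2r -!EFinB.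
by case: ifP => // _; congr _%:E; ring.
Qed.

Lemma integral_translation a h (D : set R) : measurable D ->
  measurable_fun setT h -> (forall x, 0 <= h x)%E ->
  (\int[mu]_(x in D) h x =
   \int[mu]_(x in (translation a @^-1` D : set R)) h ((x : R) + a)%R)%E.
Proof.
move=> mD mh h0.
rewrite -(ge0_integral_pushforward (measurable_translation a)) //; last first.
  exact: measurable_funTS.
apply: eq_measure_integral; first exact: measurable_translation.
by move=> mt A mA _; rewrite /= lebesgue_measure_translation.
Qed.

Lemma negligible_translation a (N : set R) :
  mu.-negligible N -> mu.-negligible [set x | N (x + a)].
Proof.
move=> [A [mA A0 NA]]; exists (translation a @^-1` A); split.
- rewrite -[X in measurable X]setTI; exact: measurable_translation.
- by rewrite -[LHS]/(pushforward mu (translation a) A) lebesgue_measure_translation.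
- by move=> x /NA.
Qed.

Lemma ae_translation a (P : R -> Prop) :
  {ae mu, forall x, P x} -> {ae mu, forall x, P (x + a)}.
Proof. exact: negligible_translation. Qed.

Lemma ae_imply (P Q : R -> Prop) : (forall x, P x -> Q x) ->
  {ae mu, forall x, P x} -> {ae mu, forall x, Q x}.
Proof. by move=> PQ; apply: (@filterS _ _ (ae_filter_ringOfSetsType mu)). Qed.

Lemma ae_imply2 (P Q S : R -> Prop) : (forall x, P x -> Q x -> S x) ->
  {ae mu, forall x, P x} -> {ae mu, forall x, Q x} -> {ae mu, forall x, S x}.
Proof. by move=> PQS; apply: (@filterS2 _ _ (ae_filter_ringOfSetsType mu)). Qed.

(** The translated period [[- a, 2 - a]] is covered by two consecutive periods;
    the factor 2 is harmless for limits equal to zero. *)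
Lemma integral_period_shift h a : 0 <= a <= 2 -> (forall x, h (x + 2)%R = h x) ->
  measurable_fun setT h -> (forall x, 0 <= h x)%E ->
  (\int[mu]_(x in `[0%R, 2%R]) h ((x : R) - a)%R <=
   2%:E * \int[mu]_(x in `[0%R, 2%R]) h x)%E.
Proof.
move=> /andP[a0 a2] hper mh h0.
have pre (b c d : R) : translation b @^-1` `[c, d]%classic = `[c - b, d - b]%classic.
  by apply/seteqP; split => x /=; rewrite !in_itv/= lerBlDr lerBrDr.
have -> : (\int[mu]_(x in `[0%R, 2%R]) h ((x : R) - a)%R =
    \int[mu]_(x in `[(- a)%R, (2 - a)%R]) h x)%E.
  by rewrite [RHS](@integral_translation (- a))// pre opprK subrK addNr.
have left2 : (\int[mu]_(x in `[(- 2)%R, 0%R]) h x = \int[mu]_(x in `[0%R, 2%R]) h x)%E.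
  rewrite (@integral_translation (-2))// pre subrr opprK add0r.
  by apply: eq_integral => x _; rewrite -[in RHS](subrK 2 x) hper.
apply: (@le_trans _ _ (\int[mu]_(x in `[(-2)%R, 0%R] `|` `]0%R, 2%R]) h x)%E).
  apply: ge0_subset_integral => //; first exact: measurableU.
    exact: measurable_funTS.
  move=> x /=; rewrite !in_itv/= => /andP[h1 h2].
  by case: (leP x 0) => hx; [left|right]; lra.
rewrite ge0_integral_setU//; last 2 first.
  exact: measurable_funTS.
  apply/disj_setPS => x /=; rewrite !in_itv/=; lra.
rewrite left2 mule_natl mule2n leeD2l//.
apply: ge0_subset_integral => //; first exact: measurable_funTS.
by move=> x /=; rewrite !in_itv/=; lra.
Qed.

End Translation.

(** * Mean-square convergence on the circle *)

Section ComplexMeasurable.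
Variable R : realType.
Local Notation mu := (@lebesgue_measure R).
Implicit Types (u v : R -> R[i]).

Definition cmeasurable u : Prop :=
  measurable_fun setT (fun z => complex.Re (u z)) /\
  measurable_fun setT (fun z => complex.Im (u z)).

Lemma cmeasurable_cst (c : R[i]) : cmeasurable (fun=> c).
Proof. by split; exact: measurable_cst. Qed.

Lemma cmeasurableD u v : cmeasurable u -> cmeasurable v ->
  cmeasurable (fun z => u z + v z).
Proof.
move=> [ru iu] [rv iv]; split.
- apply: eq_measurable_fun (measurable_funD ru rv) => z _ /=.
  by case: (u z) (v z) => ? ? [].
- apply: eq_measurable_fun (measurable_funD iu iv) => z _ /=.
  by case: (u z) (v z) => ? ? [].
Qed.

Lemma cmeasurableM u v : cmeasurable u -> cmeasurable v ->
  cmeasurable (fun z => u z * v z).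
Proof.
move=> [ru iu] [rv iv]; split.
- apply: eq_measurable_fun
    (measurable_funB (measurable_funM ru rv) (measurable_funM iu iv)) => z _ /=.
  by case: (u z) (v z) => ? ? [].
- apply: eq_measurable_fun
    (measurable_funD (measurable_funM ru iv) (measurable_funM iu rv)) => z _ /=.
  by case: (u z) (v z) => ? ? [].
Qed.

Lemma cmeasurableB u v : cmeasurable u -> cmeasurable v ->
  cmeasurable (fun z => u z - v z).
Proof.
move=> mu' mv; have := cmeasurableD mu' (cmeasurableM (cmeasurable_cst (-1)) mv).
suff -> : (fun z => u z + -1 * v z) = (fun z => u z - v z) by [].
by apply/funext => z; rewrite mulN1r.
Qed.

Lemma cmeasurable_sum n (f : nat -> R -> R[i]) :
  (forall k, cmeasurable (f k)) -> cmeasurable (fun z => \sum_(k < n) f k z).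
Proof.
move=> mf; elim: n => [|n ih].
  rewrite (_ : (fun=> _) = fun=> 0); first exact: cmeasurable_cst.
  by apply/funext => z; rewrite big_ord0.
rewrite (_ : (fun=> _) = fun z => \sum_(k < n) f k z + f n z).
  exact: cmeasurableD.
by apply/funext => z; rewrite big_ord_recr.
Qed.

Lemma cmeasurable_shift u a : cmeasurable u -> cmeasurable (fun z => u (z + a)).
Proof.
by move=> [ru iu]; split; [exact: measurableT_comp ru (@measurable_translation R a)
                          |exact: measurableT_comp iu (@measurable_translation R a)].
Qed.

Lemma cmeasurable_cis (a : R) : cmeasurable (fun z => cis (a * z)).
Proof.
by split; apply: continuous_measurable_fun; apply: continuous_dilation;
  [exact: continuous_cos|exact: continuous_sin].
Qed.

(** Exhibits the square wave as a continuous function of the floor, whence its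
    measurability. *)
Lemma square_waveE (z : R) : square_wave z = ((cos (pi * (Num.floor z)%:~R))%:C)%C.
Proof.
have E (n : nat) : ((cos (pi * n%:R : R))%:C)%C = (-1) ^+ n.
  elim: n => [|n ih]; first by rewrite mulr0 cos0 expr0.
  by rewrite -natr1 mulrDr mulr1 cosDpi exprS mulN1r -ih -rmorphN.
rewrite /square_wave expN1r -E; case: (Num.floor z) => n //.
by rewrite NegzE abszN mulrNz mulrN cosN.
Qed.

Lemma cmeasurable_square_wave : cmeasurable (@square_wave R).
Proof.
split.
- rewrite (_ : (fun z => _) = (fun z => cos (pi * z)) \o (fun z => (Num.floor z)%:~R)).
    apply: measurableT_comp.
      exact: continuous_measurable_fun (continuous_dilation (@continuous_cos R)).
    apply: nondecreasing_measurable => // x y xy.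
    by rewrite ler_int le_floor.
  by apply/funext => z; rewrite square_waveE.
- rewrite (_ : (fun z => _) = fun=> 0); first exact: measurable_cst.
  by apply/funext => z; rewrite square_waveE.
Qed.

Lemma normc_sqr (x : R[i]) : Normc.normc x ^+ 2 = complex.Re x ^+ 2 + complex.Im x ^+ 2.
Proof. by case: x => a b /=; rewrite sqr_sqrtr// addr_ge0// sqr_ge0. Qed.

Lemma normc_sqrD (x y : R[i]) :
  Normc.normc (x + y) ^+ 2 <= 2 * (Normc.normc x ^+ 2 + Normc.normc y ^+ 2).
Proof.
rewrite !normc_sqr; case: x => a b; case: y => c d /=.
by have := sqr_ge0 (a - c); have := sqr_ge0 (b - d); lra.
Qed.

Lemma measurable_normc_sqr u : cmeasurable u ->
  measurable_fun setT (fun z => (Normc.normc (u z) ^+ 2)%:E).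
Proof.
move=> [ru iu]; apply/measurable_EFinP.
apply: eq_measurable_fun (measurable_funD (measurable_funX 2 ru) (measurable_funX 2 iu)).
by move=> z _; rewrite normc_sqr.
Qed.

Definition sqr_norm u : \bar R :=
  (\int[mu]_(z in `[0%R, 2%R]) (Normc.normc (u z) ^+ 2)%:E)%E.

Lemma sqr_norm_ge0 u : (0 <= sqr_norm u)%E.
Proof. by apply: integral_ge0 => z _; rewrite lee_fin sqr_ge0. Qed.

(** Measurability is included because the integral is additive only on
    measurable functions. *)
Definition l2_null (e : nat -> R -> R[i]) : Prop :=
  (forall N, cmeasurable (e N)) /\ sqr_norm (e N) @[N --> \oo] --> 0%E.

Lemma cvge0_le (a b : nat -> \bar R) (c : R) : (forall N, 0 <= a N <= c%:E * b N)%E ->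
  b N @[N --> \oo] --> 0%E -> a N @[N --> \oo] --> 0%E.
Proof.
move=> ab b0; apply: (@squeeze_cvge _ _ _ _ (fun=> 0%E) a (fun N => c%:E * b N)%E).
- by near=> N.
- exact: cvg_cst.
- by rewrite -[X in _ --> X](mule0 c%:E); exact: cvgeZl.
Unshelve. all: by end_near. Qed.

Lemma l2_nullD e e' : l2_null e -> l2_null e' -> l2_null (fun N z => e N z + e' N z).
Proof.
move=> [me c] [me' c']; split=> [N|]; first exact: cmeasurableD.
apply: (@cvge0_le _ (fun N => sqr_norm (e N) + sqr_norm (e' N))%E 2) => [N|].
  have g0 u z : (0%R <= (Normc.normc (u z) ^+ 2)%:E)%E.
    by rewrite lee_fin sqr_ge0.
  have mn u : cmeasurable u -> measurable_fun (`[0%R, 2%R] : set R)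
      (fun z => (Normc.normc (u z) ^+ 2)%:E).
    by move=> mv; apply: measurable_funTS; exact: measurable_normc_sqr.
  rewrite sqr_norm_ge0/= /sqr_norm -ge0_integralD//; [|exact: mn..].
  rewrite -ge0_integralZl//; last 2 first.
  - by apply: emeasurable_funD; exact: mn.
  - by move=> z _; rewrite adde_ge0.
  apply: ge0_le_integral => //.
  - by move=> z _; exact: g0 (fun z => e N z + e' N z) z.
  - by apply: mn; exact: cmeasurableD.
  - by apply: measurable_funeM; apply: emeasurable_funD; exact: mn.
  - by move=> z _; rewrite -EFinD -EFinM lee_fin normc_sqrD.
by rewrite -[X in _ --> X](adde0 0%E); exact: cvgeD.
Qed.

Lemma l2_nullZ e c : l2_null e -> l2_null (fun N z => c * e N z).
Proof.
move=> [me ce]; split=> [N|]; first exact/cmeasurableM/me/cmeasurable_cst.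
apply: (@cvge0_le _ (fun N => sqr_norm (e N)) (Normc.normc c ^+ 2)) => // N.
rewrite sqr_norm_ge0/= /sqr_norm -ge0_integralZl//; last 3 first.
- by apply: measurable_funTS; exact: measurable_normc_sqr.
- by move=> z _; rewrite lee_fin sqr_ge0.
- by rewrite lee_fin sqr_ge0.
rewrite le_eqVlt; apply/orP; left; apply/eqP; apply: eq_integral => z _.
by rewrite Normc.normcM exprMn EFinM.
Qed.

Lemma l2_null_sum n (e : nat -> nat -> R -> R[i]) :
  (forall r, (r < n)%N -> l2_null (e r)) ->
  l2_null (fun N z => \sum_(r < n) e r N z).
Proof.
elim: n => [|n ih] He.
  have -> : (fun N z => \sum_(r < 0) e r N z) = (fun=> fun=> 0).
    by apply/funext => N; apply/funext => z; rewrite big_ord0.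
  split=> [N|]; first exact: cmeasurable_cst.
  rewrite (_ : (fun=> sqr_norm _) = fun=> 0%E); first exact: cvg_cst.
  apply/funext => N; apply: integral0_eq => z _.
  by rewrite Normc.normc0 expr0n.
have -> : (fun N z => \sum_(r < n.+1) e r N z) =
    (fun N z => \sum_(r < n) e r N z + e n N z).
  by apply/funext => N; apply/funext => z; rewrite big_ord_recr.
by apply: l2_nullD; [apply: ih => r /ltnW; exact: He|exact: He].
Qed.

Lemma l2_null_shift e (a : R) : 0 <= a <= 2 -> (forall N, periodic (e N) 2) ->
  l2_null e -> l2_null (fun N z => e N (z - a)).
Proof.
move=> a02 pe [me ce]; split=> [N|]; first exact: cmeasurable_shift.
apply: (@cvge0_le _ (fun N => sqr_norm (e N)) 2) => // N.
rewrite sqr_norm_ge0/= /sqr_norm.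
apply: (@integral_period_shift R (fun z => (Normc.normc (e N z) ^+ 2)%:E)) => //.
- by move=> z; rewrite pe.
- exact: measurable_normc_sqr.
- by move=> z; rewrite lee_fin sqr_ge0.
Qed.

(** A vanishing squared norm gives a null set inside one period; the
    exceptional set is contained in the union of the countably many translates
    of this one by even integers. *)
Lemma l2_null_cst u : l2_null (fun=> u) -> periodic u 2 ->
  {ae mu, forall z, u z = 0}.
Proof.
move=> [/(_ 0%N) mu0 c] pu.
have s0 : sqr_norm u = 0%E.
  by apply: cvg_unique c => //; exact: cvg_cst.
have ae01 : {ae mu, forall z : R, 0 <= z <= 2 -> u z = 0}.
  have : ae_eq mu (`[0%R, 2%R]%classic : set R)
      (fun z => (Normc.normc (u z) ^+ 2)%:E) (cst 0%E).
    apply/ae_eq_integral_abs => //.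
      by apply: measurable_funTS; exact: measurable_normc_sqr.
    rewrite -[RHS]s0; apply: eq_integral => z _.
    by rewrite gee0_abs// lee_fin sqr_ge0.
  apply: filterS => z /= H z02; apply: Normc.eq0_normc.
  have /H[/eqP] : z \in `[0%R, 2%R] by rewrite in_itv.
  by rewrite sqrf_eq0 => /eqP.
have perZ (k : int) z : u (z + k%:~R * 2) = u z.
  have pos (n : nat) y : u (y + n%:R * 2) = u y.
    elim: n => [|n ih]; first by rewrite mul0r addr0.
    by rewrite -natr1 mulrDl mul1r addrA pu.
  case: k => n; first exact: pos.
  by rewrite NegzE mulrNz -[in RHS](subrK (n.+1%:R * 2) z) pos mulNr.
have all_n : {ae mu, forall z (n : nat), 0 <= z + n%:R * 2 <= 2 -> u z = 0}.
  apply/ae_foralln => n.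
  have := ae_translation (n%:R * 2) ae01; apply: ae_imply => z H /H.
  by rewrite (perZ n).
have all_n' : {ae mu, forall z (n : nat), 0 <= z + - n%:R * 2 <= 2 -> u z = 0}.
  apply/ae_foralln => n.
  have := ae_translation (- n%:R * 2) ae01; apply: ae_imply => z H /H.
  by have := perZ (- n%:Z) z; rewrite mulrNz => ->.
move: all_n all_n'; apply: ae_imply2 => z H1 H2.
have /andP[f1 f2] := floor_itv (z / 2).
case E : (Num.floor (z / 2)) f1 f2 => [n|n].
  by rewrite intrD -pmulrn => f1 f2; apply: (H2 n); lra.
by rewrite intrD NegzE mulrNz -pmulrn => f1 f2; apply: (H1 n.+1); lra.
Qed.

End ComplexMeasurable.

(** * Uniqueness of the wave, and the wave at time zero *)

Section Waves.
Variable R : realType.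
Local Notation mu := (@lebesgue_measure R).
Implicit Types (s z : R) (u v : R -> R[i]) (n : int).

Lemma wave_term_per s n z : wave_term s n (z + 2) = wave_term s n z.
Proof.
rewrite /wave_term; congr (_ * _).
have -> : pi * n%:~R * (z + 2) = pi * n%:~R * z + 2 * pi * n%:~R :> R by ring.
by rewrite cisD cis_2pi_int mulr1.
Qed.

Lemma wave_partial_sum_per s N : periodic (wave_partial_sum s N) 2.
Proof. by move=> z; apply: eq_bigr => k _; rewrite !wave_term_per. Qed.

Lemma cmeasurable_wave_term s n : cmeasurable (wave_term s n).
Proof. by apply: cmeasurableM; [exact: cmeasurable_cst|exact: cmeasurable_cis]. Qed.

Lemma cmeasurable_wave_partial_sum s N : cmeasurable (wave_partial_sum s N).
Proof.
apply: (@cmeasurable_sum R N (fun k z => wave_term s (k.*2.+1)%:Z z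
                                       + wave_term s (- (k.*2.+1)%:Z) z)) => k.
by apply: cmeasurableD; exact: cmeasurable_wave_term.
Qed.

(** At time zero the terms of frequencies n and - n add up to a real sine. *)
Lemma wave_partial_sum0 N z : wave_partial_sum 0 N z = ((sine_sum N z)%:C)%C.
Proof.
rewrite /wave_partial_sum /sine_sum rmorph_sum/=; apply: eq_bigr => k _.
rewrite /wave_term /phase !mulr0 oppr0 cis0 !mulr1 mulrNz -pmulrn.
rewrite mulrN [_ * z in X in _ + X]mulNr.
rewrite /odd_coef /odd_mode; set a := pi * _.
have a0 : a != 0 by rewrite mulf_neq0 ?gt_eqF ?pi_gt0 ?pnatr_eq0.
rewrite /cis cosN sinN.
apply/eqP; rewrite eq_complex /=; apply/andP; split; apply/eqP; field; exact: a0.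
Qed.

Lemma is_carpet_wave_l2 s u : is_carpet_wave s u ->
  l2_null (fun N z => u z - wave_partial_sum s N z).
Proof.
move=> [pu ru iu cu]; split=> // N.
by apply: cmeasurableB => //; exact: cmeasurable_wave_partial_sum.
Qed.

(** The difference of two waves is the difference of their errors of
    approximation by the same partial sums. *)
Lemma is_carpet_wave_unique s u v : is_carpet_wave s u -> is_carpet_wave s v ->
  {ae mu, forall z, u z = v z}.
Proof.
move=> Hu Hv.
have : l2_null (fun=> (fun z => u z - v z)).
  have := l2_nullD (is_carpet_wave_l2 Hu) (l2_nullZ (-1) (is_carpet_wave_l2 Hv)).
  congr l2_null; apply/funext => N; apply/funext => z; ring.
move=> /l2_null_cst H; have : {ae mu, forall z, u z - v z = 0}.
  by apply: H => z; case: Hu Hv => [pu _ _ _] [pv _ _ _]; rewrite pu pv.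
by apply: ae_imply => z /eqP; rewrite subr_eq0 => /eqP.
Qed.

Lemma carpet_waveP s u : is_carpet_wave s u -> is_carpet_wave s (carpet_wave s).
Proof. by move=> Hu; apply: (@xgetPex _ (cst 0) [set v | is_carpet_wave s v]); exists u. Qed.

Lemma carpet_wave_ae s u : is_carpet_wave s u ->
  {ae mu, forall z, carpet_wave s z = u z}.
Proof. by move=> Hu; exact: is_carpet_wave_unique (carpet_waveP Hu) Hu. Qed.

Lemma odd_coef_sqr_ge0 k : 0 <= odd_coef R k ^+ 2 / 2.
Proof. by rewrite divr_ge0// sqr_ge0. Qed.

Lemma integral_square_error N :
  (\int[mu]_(z in `[0%R, 1%R]) ((1 - sine_sum N z) ^+ 2)%:E = (square_error R N)%:E)%E.
Proof. exact: unit_primitive_integral (unit_primitive_square_error R N). Qed.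

Lemma square_error_ge0 N : 0 <= square_error R N.
Proof.
rewrite -lee_fin -integral_square_error.
by apply: integral_ge0 => z _; rewrite lee_fin sqr_ge0.
Qed.

(** The error decreases with N, so it can be compared with its value at the
    largest power of 2 below N. *)
Lemma square_error_le N : (0 < N)%N -> square_error R N <= 2 / N%:R.
Proof.
move=> N0; set m := trunc_log 2 N.
have /andP[m1 m2] := trunc_log_bounds (isT : 1 < 2)%N N0.
apply: (@le_trans _ _ (square_error R (2 ^ m))).
  rewrite /square_error lerB// -!(big_mkord predT (fun k => odd_coef R k ^+ 2 / 2)).
  rewrite (@big_cat_nat _ _ _ (2 ^ m) 0 N)//= lerDl sumr_ge0// => k _.
  exact: odd_coef_sqr_ge0.
apply: (le_trans (square_error_dyadic R m)).
rewrite ler_pdivlMr ?ltr0n// mulrC ler_pdivrMr ?ltr0n ?expn_gt0//.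
by rewrite -natrM ler_nat -expnS ltnW.
Qed.

Lemma square_error_cvg0 : square_error R N @[N --> \oo] --> (0 : R).
Proof.
apply: (@squeeze_cvgr _ _ _ _ (fun=> 0) (fun N => 2 / N%:R)).
- near=> N; rewrite square_error_ge0 square_error_le//.
  by near: N; exists 1%N.
- exact: cvg_cst.
- rewrite -[X in _ --> X](mulr0 2); apply: cvgMr.
  rewrite gtr0_cvgV0; first exact: cvgr_idn.
  by near=> N; rewrite ltr0n; near: N; exists 1%N.
Unshelve. all: by end_near. Qed.

(** Both the square wave and the odd sines change sign under a translation by
    1, so the squared error has period 1 and its integral over the circle is
    twice [square_error N]. *)
Lemma is_carpet_wave_square_wave : is_carpet_wave 0 (@square_wave R).
Proof.
have [mr mi] := cmeasurable_square_wave R.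
split=> //; first exact: square_wave_per.
apply: (@cvge0_le _ _ (fun N => (square_error R N)%:E) 2) => [N|]; last first.
  by apply: cvg_EFin; [near=> N|exact: square_error_cvg0].
set h := fun z : R => (Normc.normc (square_wave z - wave_partial_sum 0 N z) ^+ 2)%:E.
have h0 z : (0 <= h z)%E by rewrite lee_fin sqr_ge0.
have mh : measurable_fun setT h.
  by apply: measurable_normc_sqr; apply: cmeasurableB => //;
    exact: cmeasurable_wave_partial_sum.
have h1 z : h (z + 1) = h z.
  rewrite /h square_waveS !wave_partial_sum0.
  have -> : sine_sum N (z + 1) = - sine_sum N z.
    rewrite -sumrN; apply: eq_bigr => k _; rewrite /odd_mode mulrDr mulr1 sinD.
    by rewrite cos_pi_odd sin_pi_nat mulrN1 mulr0 addr0 mulrN.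
  rewrite rmorphN/= -opprD !normc_sqr.
  by case: (square_wave z - _) => a b /=; rewrite !sqrrN.
have right1 : (\int[mu]_(z in `[1%R, 2%R]) h z = \int[mu]_(z in `[0%R, 1%R]) h z)%E.
  rewrite (@integral_translation R 1)//.
  have -> : (translation 1 @^-1` `[1%R, 2%R]%classic : set R) = `[0, 1]%classic.
    by apply/seteqP; split => x /=; rewrite !in_itv/= /translation; lra.
  by apply: eq_integral => z _; rewrite h1.
have left1 : (\int[mu]_(z in `[0%R, 1%R]) h z = (square_error R N)%:E)%E.
  rewrite -integral_square_error.
  rewrite -!integral_itv_bndo_bndc; first last.
  - exact: measurable_funTS.
  - apply: measurable_funTS; apply/measurable_EFinP.
    by apply: continuous_measurable_fun; case: (unit_primitive_square_error R N).
  apply: eq_integral => z; rewrite inE/= in_itv/= => z01; congr _%:E.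
  have -> : square_wave z = ((1 : R)%:C)%C by rewrite /square_wave (floor_def (m := 0)).
  by rewrite wave_partial_sum0 -rmorphB normc_sqr/= expr0n addr0.
apply/andP; split; first by apply: integral_ge0 => z _; exact: h0.
rewrite -left1.
have -> : `[0%R, 2%R]%classic = `[0%R, 1%R]%classic `|` `]1%R, 2%R]%classic :> set R.
  by apply/seteqP; split => x /=; rewrite !in_itv/= ?leNgt; case: (ltrP 1 x); lra.
rewrite ge0_integral_setU//; last 3 first.
- exact: measurable_funTS.
- by move=> x _; exact: h0.
- by apply/disj_setPS => x /=; rewrite !in_itv/=; lra.
rewrite mule_natl mule2n leeD2l// -right1.
apply: ge0_subset_integral => //.
- exact: measurable_funTS.
- by move=> x _; exact: h0.
- by move=> x /=; rewrite !in_itv/=; lra.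
Unshelve. all: by end_near. Qed.

End Waves.

(** * The revival at rational times *)

Section RationalWave.
Variables (R : realType) (p : int) (q : nat).
Hypothesis q_gt0 : (0 < q)%N.
Local Notation mu := (@lebesgue_measure R).
Local Notation s := (p%:~R / q%:R : R).

Let q0 : (q%:R : R) != 0.
Proof. by rewrite pnatr_eq0 -lt0n. Qed.

Let qp : 0 < (q%:R : R).
Proof. by rewrite ltr0n. Qed.

Definition superposition (u : R -> R[i]) z : R[i] :=
  \sum_(r < q) chat R p q r * u (z - 2 * r%:R / q%:R).

(** A translation by 2r/q multiplies the mode of frequency n by the character
    [exp (- 2 i pi r n / q)]. *)
Lemma wave_term_superposition n z :
  wave_term s n z = superposition (wave_term 0 n) z.
Proof.
rewrite /wave_term (phase_dft R p q_gt0 n) big_distrr big_distrl/=.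
apply: eq_bigr => r _.
have -> : pi * n%:~R * (z - 2 * r%:R / q%:R) =
   - (2 * pi * r%:R * n%:~R / q%:R) + pi * n%:~R * z :> R by field.
by rewrite cisD /phase mulr0 oppr0 cis0; ring.
Qed.

Lemma wave_partial_sum_superposition N z :
  wave_partial_sum s N z = superposition (wave_partial_sum 0 N) z.
Proof.
rewrite /superposition /wave_partial_sum.
under [RHS]eq_bigr do rewrite big_distrr/=.
rewrite exchange_big/=; apply: eq_bigr => k _.
rewrite !wave_term_superposition -big_split/=.
by apply: eq_bigr => r _; rewrite mulrDr.
Qed.

(** By linearity of [superposition] the errors of approximation are the
    superpositions of the errors for the square wave, and each translate of
    these is again null in mean square. *)
Lemma is_carpet_wave_superposition : is_carpet_wave s (superposition (@square_wave R)).
Proof.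
have [mr mi] : cmeasurable (superposition (@square_wave R)).
  apply: (@cmeasurable_sum R q
    (fun r z => chat R p q r * square_wave (z - 2 * r%:R / q%:R))) => r.
  apply: cmeasurableM; first exact: cmeasurable_cst.
  exact: cmeasurable_shift (cmeasurable_square_wave R).
split=> //.
  by move=> z; apply: eq_bigr => r _; rewrite addrAC square_wave_per.
have l0 := is_carpet_wave_l2 (is_carpet_wave_square_wave R).
have [_] : l2_null (fun N z => superposition (@square_wave R) z - wave_partial_sum s N z).
  have : l2_null (fun N z => \sum_(r < q) chat R p q r *
      (square_wave (z - 2 * r%:R / q%:R) - wave_partial_sum 0 N (z - 2 * r%:R / q%:R))).
    apply: (@l2_null_sum R q (fun r N z => chat R p q r *
      (square_wave (z - 2 * r%:R / q%:R) - wave_partial_sum 0 N (z - 2 * r%:R / q%:R)))).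
    move=> r rq; apply: l2_nullZ.
    apply: (@l2_null_shift R (fun N z => square_wave z - wave_partial_sum 0 N z)) => //.
      rewrite divr_ge0 ?mulr_ge0 ?ler0n//= ler_pdivrMr// ler_pM2l//.
      by rewrite ler_nat ltnW.
    by move=> N z; rewrite square_wave_per wave_partial_sum_per.
  congr l2_null; apply/funext => N; apply/funext => z.
  rewrite wave_partial_sum_superposition -sumrB.
  by apply: eq_bigr => r _; rewrite mulrBr.
by [].
Qed.

Lemma carpet_wave_superposition_ae :
  {ae mu, forall z, carpet_wave s z = superposition (@square_wave R) z}.
Proof. exact: carpet_wave_ae is_carpet_wave_superposition. Qed.

Lemma carpet_wave_revival_ae :
  {ae mu, forall z, carpet_wave s z = superposition (carpet_wave 0) z}.
Proof.
have all_r : {ae mu, forall z (r : nat),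
    carpet_wave 0 (z - 2 * r%:R / q%:R) = square_wave (z - 2 * r%:R / q%:R)}.
  apply/ae_foralln => r.
  exact: ae_translation _ (carpet_wave_ae (is_carpet_wave_square_wave R)).
apply: ae_imply2 carpet_wave_superposition_ae all_r => z -> Hr.
by apply: eq_bigr => r _; rewrite Hr.
Qed.

(** An open cell contains no lattice point, hence no integer, so the floor is
    constant on it. *)
Lemma floor_cell (m : int) (x : R) : m%:~R / q%:R < x < (m + 1)%:~R / q%:R ->
  Num.floor x = (m %/ q%:Z)%Z.
Proof.
move=> /andP[h1 h2]; apply: floor_def; apply/andP; split.
  apply: le_trans (ltW h1); rewrite ler_pdivlMr// pmulrn -intrM ler_int.
  by rewrite lez_floor //; lia.
apply: (lt_le_trans h2); rewrite ler_pdivrMr// pmulrn -intrM ler_int.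
by have := @ltz_ceil m q%:Z; lia.
Qed.

(** A translation by 2r/q maps cells to cells, so every translate of the square
    wave takes on the whole cell the value that it takes at the midpoint. *)
Lemma carpet_weight_cell_ae :
  {ae mu, forall z, forall l : 'I_q, l%:R / q%:R < z < l.+1%:R / q%:R ->
     carpet_weight s z = cell_weight R p q l}.
Proof.
apply: ae_imply carpet_wave_superposition_ae => z zE l /andP[lz zl].
rewrite /carpet_weight /cell_weight zE; congr (Normc.normc _ ^+ 2).
apply: eq_bigr => r _; congr (_ * _).
have E (x : R) : l%:R / q%:R < x < l.+1%:R / q%:R ->
    Num.floor (x - 2 * r%:R / q%:R) = ((l%:Z - 2 * r%:Z) %/ q%:Z)%Z.
  move=> /andP[h1 h2]; apply: floor_cell.
  rewrite !(intrD, mulrNz, intrM) -!pmulrn.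
  have -> : (l%:R - 2%:~R * r%:R) / q%:R = l%:R / q%:R - 2 * r%:R / q%:R :> R by field.
  have -> : (l%:R - 2%:~R * r%:R + 1%:~R) / q%:R = l.+1%:R / q%:R - 2 * r%:R / q%:R :> R.
    by rewrite -natr1; field.
  by rewrite !ltrD2r h1.
rewrite /square_wave E ?lz// E//.
rewrite !ltr_pM2r ?invr_gt0// ltrDl -[X in _ && (_ < X)]natr1 ltrD2l.
by rewrite invr_gt0 ltr0n invf_lt1 ?ltr1n ?ltr0n.
Qed.

End RationalWave.

(** * The probability integral transform *)

Section DensityProbability.
Context {R : realType} (f : R -> R).
Local Notation mu := (@lebesgue_measure R).

(** The hypotheses on [f] are arguments so that the measure and probability
    structures can be attached to this constant. *)
Definition density_prob (mf : measurable_fun [set: R] f) (f0 : forall x, 0 <= f x)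
    (f1 : (\int[mu]_x (f x)%:E = 1)%E) : set (measurableTypeR R) -> \bar R :=
  fun A => (\int[mu]_(x in A) (f x)%:E)%E.

Hypothesis mf : measurable_fun [set: R] f.
Hypothesis f0 : forall x, 0 <= f x.
Hypothesis f1 : (\int[mu]_x (f x)%:E = 1)%E.

Let P := density_prob mf f0 f1.

Let P0 : P set0 = 0%E.
Proof. by rewrite /P /density_prob integral_set0. Qed.

Let P_ge0 A : (0 <= P A)%E.
Proof. by apply: integral_ge0 => x _; rewrite lee_fin. Qed.

Let P_sigma_additive : semi_sigma_additive P.
Proof.
move=> /= F mF tF mUF; rewrite /P /density_prob; apply: cvg_toP.
  apply: ereal_nondecreasing_is_cvgn => m n mn.
  apply: lee_sum_nneg_natr => // k _ _.
  by apply: integral_ge0 => x _; rewrite lee_fin.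
rewrite ge0_integral_bigcup//=.
- by apply: measurable_funTS; apply: measurableT_comp.
- by move=> x _; rewrite lee_fin.
Qed.

HB.instance Definition _ := isMeasure.Build _ _ _ (density_prob mf f0 f1)
  P0 P_ge0 P_sigma_additive.

Let P_setT : P [set: _] = 1%:E.
Proof. exact: f1. Qed.

HB.instance Definition _ := @Measure_isProbability.Build _ _ R
  (density_prob mf f0 f1) P_setT.

Let id_R : measurableTypeR R -> R := idfun.
#[local] HB.instance Definition _ :=
  @isMeasurableFun.Build _ _ _ _ id_R (@measurable_id _ _ setT).

Local Notation F := (dist_fun f).
Local Notation Pf := (density_prob mf f0 f1 : probability _ _).

Lemma density_prob_ray x : Pf `]-oo, x]%classic = (F x)%:E.
Proof.
have /fineK <- : Pf `]-oo, x]%classic \is a fin_num by exact: fin_num_measure.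
by [].
Qed.

Lemma cdf_density x : cdf (id_R : {RV Pf >-> R}) x = (F x)%:E.
Proof. by rewrite -density_prob_ray. Qed.

Lemma dist_fun_ge0 x : 0 <= F x.
Proof. by rewrite -lee_fin -density_prob_ray. Qed.

Lemma dist_fun_le1 x : F x <= 1.
Proof. by rewrite -lee_fin -density_prob_ray; exact: probability_le1. Qed.

Lemma dist_fun_nondecreasing : {homo F : x y / x <= y}.
Proof.
move=> x y xy; rewrite -lee_fin -!density_prob_ray; apply: le_measure; rewrite ?inE//.
exact: subitvPr.
Qed.

Lemma measurable_dist_fun : measurable_fun setT F.
Proof. by apply: nondecreasing_measurable => //; exact: dist_fun_nondecreasing. Qed.

Lemma integrable_density : mu.-integrable setT (EFin \o f).
Proof.
apply/integrableP; split; first exact/measurable_EFinP.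
under eq_integral do rewrite /= ger0_norm//.
by rewrite f1 ltry.
Qed.

(** From [a] on, [F] is the sum of [F a] and of an integral with variable
    upper bound. *)
Lemma continuous_dist_fun a b : a <= b -> {within `[a, b], continuous F}.
Proof.
move=> ab.
have ifab : mu.-integrable `[a, b] (EFin \o f) by exact: integrableS integrable_density.
have := parameterized_integral_continuous ab ifab => cG.
have FE : {in `[a, b]%classic, (fun x => F a + parameterized_integral mu a x f) =1 F}.
  move=> x; rewrite inE/= in_itv/= => /andP[ax xb].
  have ifx : mu.-integrable `]-oo, x] (EFin \o f) by exact: integrableS integrable_density.
  have /(_ a) := Rintegral_itvB ifx.
  rewrite -/(dist_fun f x) -/(dist_fun f a) /= => /(_ isT).
  rewrite bnd_simp => /(_ ax) e.
  rewrite /parameterized_integral -Rintegral_itv_obnd_cbnd.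
    by rewrite -e addrC subrK.
  exact: integrableS integrable_density.
apply: (subspace_eq_continuous FE).
move=> x; apply: cvgD; first exact: cvg_cst.
exact: cG.
Qed.

Lemma dist_fun_onto c : 0 < c < 1 -> exists x, F x = c.
Proof.
move=> /andP[c0 c1].
have FE : F = fine \o cdf (id_R : {RV Pf >-> R}).
  by apply/funext => x; rewrite /comp cdf_density.
have Ny : F x @[x --> -oo] --> (0 : R) by rewrite FE; exact/fine_cvg/cvg_cdfNy0.
have y1 : F x @[x --> +oo] --> (1 : R) by rewrite FE; exact/fine_cvg/cvg_cdfy1.
have [a Fa] : exists a, F a < c.
  by near (-oo%R : set_system R) => a; exists a; near: a; exact: (cvgr_lt 0).
have [b Fb] : exists b, c < F b.
  by near (+oo%R : set_system R) => b; exists b; near: b; exact: (cvgr_gt (1 : R)).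
have ab : a <= b.
  rewrite leNgt; apply/negP => /ltW/dist_fun_nondecreasing; lra.
have [|x _ <-] := @IVT R F a b c ab (continuous_dist_fun ab); last by exists x.
by rewrite ge_min le_max (ltW Fa) (ltW Fb) orbT.
Unshelve. all: by end_near. Qed.

Lemma density_prob_le_ray (A : set (measurableTypeR R)) (x : R) :
  measurable A -> A `<=` `]-oo, x]%classic -> (Pf A <= (F x)%:E)%E.
Proof. by move=> mA Ax; rewrite -density_prob_ray; apply: le_measure; rewrite ?inE. Qed.

Lemma density_prob_ge_ray (A : set (measurableTypeR R)) (x : R) :
  measurable A -> `]-oo, x]%classic `<=` A -> ((F x)%:E <= Pf A)%E.
Proof. by move=> mA Ax; rewrite -density_prob_ray; apply: le_measure; rewrite ?inE. Qed.

Lemma measurable_preimage_dist_fun (A : set R) : measurable A -> measurable (F @^-1` A).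
Proof. by move=> mA; rewrite -[X in measurable X]setTI; exact: measurable_dist_fun. Qed.

(** If [F x = c] then, by monotonicity, [F < c] forces a point to the left of
    [x], which bounds the probability by [c]; for every smaller level [c - e]
    attained at [x], the ray up to [x] lies in [F < c], which bounds it below.
    Arguing with the attained levels avoids a discussion of the intervals on
    which [F] may be constant. *)
Lemma density_prob_dist_fun_lt c : 0 < c <= 1 ->
  Pf (F @^-1` `]-oo, c[%classic) = c%:E.
Proof.
move=> /andP[c0 c1].
have mA : measurable (F @^-1` `]-oo, c[%classic) by exact: measurable_preimage_dist_fun.
apply/eqP; rewrite eq_le; apply/andP; split.
  have [->|c_neq1] := eqVneq c 1.
    by apply: probability_le1; exact: measurable_preimage_dist_fun.
  have [|x Fx] := @dist_fun_onto c; first by rewrite c0 lt_neqAle c_neq1.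
  rewrite -{2}Fx; apply: density_prob_le_ray => // y /=.
  rewrite !in_itv/= => Fyc; rewrite leNgt; apply/negP => /ltW/dist_fun_nondecreasing.
  by rewrite Fx leNgt Fyc.
apply/lee_addgt0Pr => e e0.
(* For e >= c the bound is trivial; otherwise c - e is an attained level. *)
have [ec|ce] := ltP e c; last first.
  by apply: (@le_trans _ _ e%:E); rewrite ?lee_fin// leeDr.
have [|x Fx] := @dist_fun_onto (c - e); first by lra.
rewrite -leeBlDr// -EFinB -Fx; apply: density_prob_ge_ray => // y /=.
rewrite !in_itv/= => /dist_fun_nondecreasing; rewrite Fx; lra.
Qed.

(** The law of [F] and the restriction of Lebesgue measure to [[0, 1]] agree on
    the open rays to the left, which generate the Borel sets. *)
Lemma density_prob_dist_fun (A : set R) : measurable A ->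
  Pf (F @^-1` A) = mu (A `&` `[0%R, 1%R]).
Proof.
move=> mA.
have mI : measurable (`[0%R, 1%R]%classic : set R) by [].
have mF : measurable_fun [set: measurableTypeR R] (F : _ -> measurableTypeR R).
  exact: measurable_dist_fun.
pose m1 := pushforward Pf (F : measurableTypeR R -> measurableTypeR R).
pose m2 := mrestr mu mI.
suff : m1 A = m2 A by [].
pose M1 : {measure set (measurableTypeR R) -> \bar R} :=
  measure_function_pushforward__canonical__measure_function_Measure Pf mF.
apply: (@measure_unique _ R (measurableTypeR R) (@RGenInftyO.G R)
  (fun k => `]-oo, k%:R[%classic)
  _ _ _ _ M1 (mrestr mu mI)) => //.
- exact: RGenInftyO.measurableE.
- move=> _ _ [x ->] [y ->]; exists (Num.min x y); apply/seteqP; split => z /=.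
    by rewrite !in_itv/= lt_min => -[-> ->].
  by rewrite !in_itv/= lt_min => /andP.
- by move=> k; exists k%:R.
- rewrite -subTset => x _; exists (Num.trunc x).+1 => //=.
  by rewrite in_itv/= truncnS_gt.
- move=> _ [c ->].
  rewrite -[LHS]/(Pf (F @^-1` `]-oo, c[%classic)).
  rewrite -[RHS]/(mu (`]-oo, c[%classic `&` `[0%R, 1%R]%classic)).
  have [c0|c0] := leP c 0.
    rewrite (_ : F @^-1` _ = set0) ?measure0; last first.
      apply/seteqP; split => // x /=; rewrite in_itv/=.
      by have := dist_fun_ge0 x; lra.
    rewrite (_ : _ `&` _ = set0) ?measure0//.
    by apply/seteqP; split => // x /=; rewrite !in_itv/=; lra.
  have [c1|c1] := leP c 1.
    rewrite [LHS]density_prob_dist_fun_lt ?c0//.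
    rewrite (_ : _ `&` _ = `[0%R, c[%classic); last first.
      by apply/seteqP; split => // x /=; rewrite !in_itv/=; lra.
    by rewrite lebesgue_measure_itv/= lte_fin c0 oppr0 addr0.
  rewrite (_ : F @^-1` _ = setT); last first.
    apply/seteqP; split => // x _ /=; rewrite in_itv/=.
    by have := dist_fun_le1 x; lra.
  rewrite (_ : _ `&` _ = `[0%R, 1%R]%classic); last first.
    by apply/seteqP; split => // x /=; rewrite !in_itv/=; lra.
  by rewrite lebesgue_measure_itv/= lte_fin ltr01 oppr0 adde0 probability_setT.
- move=> k; rewrite (le_lt_trans (probability_le1 _ _)) ?ltry//.
  exact: measurable_preimage_dist_fun.
Qed.

(** The preimage by [F] of a null set has probability zero, so the density
    vanishes almost everywhere on it. *)
Lemma ae_dist_fun (Q : R -> Prop) : {ae mu, forall z, Q z} ->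
  {ae mu, forall x, f x = 0 \/ Q (F x)}.
Proof.
move=> [N [mN N0 QN]].
have mFN : measurable (F @^-1` N) by exact: measurable_preimage_dist_fun.
have : Pf (F @^-1` N) = 0%E.
  rewrite density_prob_dist_fun//; apply/eqP; rewrite eq_le measure_ge0 andbT -N0.
  by apply: le_measure; rewrite ?inE//; exact: measurableI.
move=> int0.
have : ae_eq mu (F @^-1` N) (EFin \o f) (cst 0%E).
  apply/ae_eq_integral_abs => //.
    by apply: measurable_funTS; exact/measurable_EFinP.
  rewrite -[RHS]int0; apply: eq_integral => x _.
  by rewrite gee0_abs// lee_fin.
apply: ae_imply => x H.
have [Nx|Nx] := pselect (N (F x)); first by left; have [] := H Nx.
by right; apply: contrapT => nQ; apply: Nx; exact: QN.
Qed.

Lemma integral_dist_fun_itv a b : 0 <= a -> a < b -> b <= 1 ->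
  (\int[mu]_(x in F @^-1` `]a, b[%classic) (f x)%:E = (b - a)%:E)%E.
Proof.
move=> a0 ab b1; rewrite [LHS](density_prob_dist_fun (A := `]a, b[%classic))//.
rewrite (_ : _ `&` _ = `]a, b[%classic); last first.
  by apply/seteqP; split => x /=; rewrite !in_itv/=; lra.
by rewrite lebesgue_measure_itv/= lte_fin ab.
Qed.

End DensityProbability.

(** * Histogram reweighting of a law *)

Section Histogram.
Variables (R : realType) (p : int) (q : nat).
Hypothesis q_gt0 : (0 < q)%N.
Local Notation mu := (@lebesgue_measure R).
Local Notation s := (p%:~R / q%:R : R).

Let q0 : (q%:R : R) != 0.
Proof. by rewrite pnatr_eq0 -lt0n. Qed.

Let qp : 0 < (q%:R : R).
Proof. by rewrite ltr0n. Qed.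

Lemma D_plus_ge0 (f : R -> R) : D_plus f -> forall x, 0 <= f x.
Proof.
move=> [[I [_ _ _ fI f0]] _] x.
by have [/fI/ltW//|/f0 ->] := pselect (I x).
Qed.

Lemma D_plus_measurable (f : R -> R) : D_plus f -> measurable_fun setT f.
Proof.
move=> [[I [oI _ cf _ f0]] _].
have -> : f = f \_ I.
  apply/funext => x; rewrite patchE; case: ifPn => //.
  by rewrite notin_setE => /f0.
have mI : measurable I by exact: open_measurable.
by apply/(measurable_restrictT _ mI); exact: subspace_continuous_measurable_fun.
Qed.

Lemma measurable_carpet_weight : measurable_fun setT (@carpet_weight R s).
Proof.
have [_ mr mi _] := carpet_waveP (is_carpet_wave_superposition R p q_gt0).
by apply/measurable_EFinP; exact: measurable_normc_sqr.
Qed.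

Lemma ae_off_lattice : {ae mu, forall z (m : nat), z != m%:R / q%:R}.
Proof.
apply/ae_foralln => m; exists [set m%:R / q%:R]; split => //.
  exact: lebesgue_measure_set1.
by move=> z /= /negP; rewrite negbK => /eqP.
Qed.

Definition step_weight (f : R -> R) x : R :=
  \sum_(l < q) cell_weight R p q l * \1_(quantile_cell f q l) x.

Section Density.
Variable f : R -> R.
Hypothesis Df : D_plus f.
Let f0 := D_plus_ge0 Df.
Let mf := D_plus_measurable Df.
Let f1 : (\int[mu]_x (f x)%:E = 1)%E.
Proof. by case: Df. Qed.

Local Notation F := (dist_fun f).

(** For almost every [x] with [f x <> 0], [F x] avoids the lattice points and
    the exceptional set of the wave, so it lies inside exactly one cell. *)
Lemma step_weight_ae :
  {ae mu, forall x, carpet_weight s (F x) * f x = step_weight f x * f x}.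
Proof.
have := ae_imply2 (fun z H1 H2 => conj H1 H2) (carpet_weight_cell_ae R p q_gt0) ae_off_lattice.
move=> /(ae_dist_fun mf f0 f1); apply: ae_imply => x [->|[H1 H2]].
  by rewrite !mulr0.
congr (_ * _).
have F0 := dist_fun_ge0 mf f0 f1 x; have F1 := dist_fun_le1 mf f0 f1 x.
have qF0 : 0 <= q%:R * F x by rewrite mulr_ge0// ltW.
have /andP[t1 t2] := truncn_itv qF0.
set l := Num.trunc (q%:R * F x) in t1 t2.
have lF : l%:R / q%:R < F x.
  by rewrite lt_neqAle eq_sym H2/= ler_pdivrMr// mulrC.
have Fl : F x < l.+1%:R / q%:R by rewrite ltr_pdivlMr// mulrC.
have lq : (l < q)%N.
  rewrite -(ltr_nat R); apply: (@lt_le_trans _ _ (q%:R * F x)).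
    by rewrite mulrC -ltr_pdivrMr.
  by rewrite -[leRHS]mulr1 ler_pM2l.
rewrite (H1 (Ordinal lq)) /= ?lF// /step_weight (bigD1 (Ordinal lq))//= big1.
  rewrite addr0 indicE mem_set ?mulr1//.
  by rewrite /quantile_cell/= in_itv/= lF.
move=> i il; rewrite indicE memNset ?mulr0// /quantile_cell/= in_itv/= => /andP[h1 h2].
have cross (a b : nat) : a%:R / q%:R < b.+1%:R / q%:R :> R -> (a <= b)%N.
  by rewrite ltr_pM2r ?invr_gt0// ltr_nat ltnS.
move/negP: il; apply; rewrite -val_eqE/= eqn_leq.
by rewrite !cross// ?(lt_trans h1 Fl)// (lt_trans lF h2).
Qed.

Lemma measurable_quantile_cell l : measurable (quantile_cell f q l).
Proof. exact: (measurable_preimage_dist_fun mf f0 f1). Qed.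

(** Each quantile cell has probability 1/q, so the mass is the mean of the cell
    values. *)
Lemma integral_step_weight : (\int[mu]_x (step_weight f x * f x)%:E = 1)%E.
Proof.
have cw0 l : 0 <= cell_weight R p q l by rewrite sqr_ge0.
transitivity (\sum_(l < q) \int[mu]_x
   ((cell_weight R p q l)%:E * ((\1_(quantile_cell f q l) x * f x)%R)%:E))%E.
  rewrite -ge0_integral_sum//; last 2 first.
  - move=> l; apply/measurable_EFinP; apply: measurable_funM => //.
    by apply: measurable_funM => //; apply: measurable_indic; exact: measurable_quantile_cell.
  - by move=> l x _; rewrite -EFinM lee_fin mulr_ge0// mulr_ge0.
  apply: eq_integral => x _; rewrite /step_weight big_distrl/= -sumEFin.
  by apply: eq_bigr => l _; rewrite -EFinM mulrA.
transitivity (\sum_(l < q) (cell_weight R p q l / q%:R)%:E)%E; last first.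
  by rewrite sumEFin -big_distrl/= sum_cell_weight// divff.
apply: eq_bigr => l _; rewrite ge0_integralZl//; last 3 first.
- apply/measurable_EFinP; apply: measurable_funM => //.
  by apply: measurable_indic; exact: measurable_quantile_cell.
- by move=> x _; rewrite lee_fin mulr_ge0.
- by rewrite lee_fin.
rewrite [RHS]EFinM; congr (_ * _)%E.
transitivity (\int[mu]_(x in quantile_cell f q l) (f x)%:E)%E.
  rewrite [RHS]integral_mkcond; apply: eq_integral => x _.
  by rewrite patchE indicE; case: (x \in _); rewrite ?mul1r ?mul0r.
rewrite (integral_dist_fun_itv mf f0 f1).
- by congr _%:E; rewrite -natr1; field.
- by rewrite divr_ge0.
- by rewrite ltr_pM2r ?invr_gt0// ltr_nat.
- by rewrite ler_pdivrMr// mul1r ler_nat.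
Qed.

Lemma integral_carpet_weight_dist_fun :
  (\int[mu]_x (carpet_weight s (F x) * f x)%:E = 1)%E.
Proof.
rewrite -integral_step_weight; apply: ge0_ae_eq_integral => //.
- apply/measurable_EFinP; apply: measurable_funM => //.
  apply: measurableT_comp; first exact: measurable_carpet_weight.
  exact: (measurable_dist_fun mf f0 f1).
- apply/measurable_EFinP; apply: measurable_funM => //.
  apply: (@measurable_sum _ _ _ _ 'I_q (index_enum _)
    (fun l x => cell_weight R p q l * \1_(quantile_cell f q l) x)) => l.
  by apply: measurable_funM => //; apply: measurable_indic; exact: measurable_quantile_cell.
- by move=> x _; rewrite lee_fin mulr_ge0// sqr_ge0.
- by move=> x _; rewrite lee_fin mulr_ge0// sumr_ge0// => l _; rewrite mulr_ge0// sqr_ge0.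
- by apply: ae_imply step_weight_ae => x + _ => ->.
Qed.

End Density.

End Histogram.

Theorem theorem41 (R : realType) (p : int) (q : nat)
    (q_gt0 : (0 < q)%N) (pq_coprime : coprime `|p|%N q) :
  let s : R := p%:~R / q%:R in
  [/\ (forall n : int, phase s (n + q%:Z) = phase s n),
      (forall n : int, phase s n =
         \sum_(r < q) chat R p q r * cis (- (2 * pi * r%:R * n%:~R / q%:R))),
      (forall r : nat, chat R p q r = (q%:R)^-1 * gauss_sum R (- p) r%:Z q) &
      [/\ {ae lebesgue_measure, forall z : R,
              carpet_wave 0 z = square_wave z},
          {ae lebesgue_measure, forall z : R,
              carpet_wave s z =
                \sum_(r < q) chat R p q r *
                  carpet_wave 0 (z - 2 * r%:R / q%:R)},
          {ae lebesgue_measure, forall z : R, forall l : 'I_q,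
              l%:R / q%:R < z < l.+1%:R / q%:R ->
              carpet_weight s z = cell_weight R p q l} &
          forall f : R -> R, D_plus f ->
            let g := carpet_flow f (s * (4 / pi)) in
            [/\ {ae lebesgue_measure, forall x : R,
                    g x = carpet_weight s (dist_fun f x) * f x},
                {ae lebesgue_measure, forall x : R,
                    g x = (\sum_(l < q) cell_weight R p q l *
                             \1_(quantile_cell f q l) x) * f x} &
                (\int[lebesgue_measure]_x (g x)%:E = 1)%E]]].
Proof.
move=> s; split.
- exact: phase_periodic.
- exact: phase_dft.
- exact: chat_gauss.
split.
- exact: carpet_wave_ae (is_carpet_wave_square_wave R).
- exact: carpet_wave_revival_ae.
- exact: carpet_weight_cell_ae.
move=> f Df g.
have sE : pi * (s * (4 / pi)) / 4 = s.
  by rewrite mulrCA [pi * _]mulrCA divff ?mulr1 ?mulfK// gt_eqF ?pi_gt0.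
have gE : g = fun x => carpet_weight s (dist_fun f x) * f x.
  by apply/funext => x; rewrite /g /carpet_flow sE.
split.
- by apply: (@filterE _ _ (ae_filter_ringOfSetsType lebesgue_measure)) => x; rewrite gE.
- by rewrite gE; exact: step_weight_ae.
- by rewrite gE; exact: integral_carpet_weight_dist_fun.
Qed.
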